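(* Fix constants $m_0>0$, $\phi_0(1)=-\phi_0(-1)>0$ and $0<\gamma_{max}<\infty$ (independent of $\varepsilon$), and set $M=\sqrt{\frac{m_0}{2e^{\phi_0(1)}}}$ and $K_0=\sup_{0<|y|\le \phi_0(1)}\frac{|e^y-1|}{|y|}$. There exist $\tilde\varepsilon>0$, depending only on $m_0$ and $\phi_0(1)$, and a constant $\alpha>0$, independent of $\varepsilon$, such that the following holds for every $0<\varepsilon<\tilde\varepsilon$. Suppose that $$0<\gamma_\varepsilon\le\gamma_{max},\qquad \frac{\gamma_\varepsilon}{\sqrt\varepsilon}>\frac{\left((1+2\gamma_{max})^2+3\right)K_0\phi_0(1)}{4M},$$ and let $(\tilde\delta,\tilde\eta,\tilde\phi)$ be a solution of the linearized perturbed problem (LP) of the context whose initial data satisfy $\int_{-1}^1\tilde\delta(x,0)\,dx=\int_{-1}^1\tilde\eta(x,0)\,dx=0$. Then, with $\bar D,\bar H,d,h$ as defined in the context, $$\frac12\int_{-1}^1(\bar D^2+\bar H^2)\,dx+d^2+h^2\le I_0e^{-\alpha t}\qquad\text{for all }t>0,$$ where $$I_0=\left[\frac12\int_{-1}^1(\bar D^2+\bar H^2)\,dx+d^2+h^2\right]_{t=0}.$$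
   Context: Boundary layer steady state. For $\varepsilon>0$, $\gamma_\varepsilon>0$ (a constant which may depend on $\varepsilon$), $m_0>0$ and constants $\phi_0(1)=-\phi_0(-1)>0$, let $\psi$ be the solution of $$\varepsilon\psi_{xx}=\frac{m_0e^{\psi}}{\int_{-1}^1e^{\psi}dx}-\frac{m_0e^{-\psi}}{\int_{-1}^1e^{-\psi}dx}\ \text{ in }(-1,1),\qquad \psi(\pm1)\pm\gamma_\varepsilon\psi_x(\pm1)=\phi_0(\pm1).$$ Put $n^0=\frac{m_0e^{\psi}}{\int_{-1}^1e^{\psi}dx}$, $p^0=\frac{m_0e^{-\psi}}{\int_{-1}^1e^{-\psi}dx}$, $\delta^0=n^0-p^0$, $\eta^0=n^0+p^0$. Linearized perturbed problem (LP), for unknowns $(\tilde\delta,\tilde\eta,\tilde\phi)$ depending on $x\in(-1,1)$, $t>0$: $$\tilde\delta_t=\tilde\delta_{xx}-(\eta^0\tilde\phi_x)_x-(\tilde\eta\psi_x)_x,\quad \tilde\eta_t=\tilde\eta_{xx}-(\delta^0\tilde\phi_x)_x-(\tilde\delta\psi_x)_x,\quad \varepsilon\tilde\phi_{xx}=\tilde\delta,$$ with boundary conditions $$\tilde\delta_x-\eta^0\tilde\phi_x-\tilde\eta\psi_x=\tilde\eta_x-\delta^0\tilde\phi_x-\tilde\delta\psi_x=0\ \text{ at }x=\pm1,\qquad \tilde\phi\pm\gamma_\varepsilon\tilde\phi_x=0\ \text{ at }x=\pm1.$$ Solutions are understood to be classical on $[-1,1]$ for $t>0$, with initial data $\tilde\delta(\cdot,0),\tilde\eta(\cdot,0)$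 attained continuously in $L^2(-1,1)$. Notation: $D(x,t)=\int_{-1}^x\tilde\delta(s,t)\,ds$, $H(x,t)=\int_{-1}^x\tilde\eta(s,t)\,ds$, $d(t)=\frac12\int_{-1}^1D(x,t)\,dx$, $h(t)=\frac12\int_{-1}^1H(x,t)\,dx$, $\bar D=D-d$, $\bar H=H-h$. *)

(* Defs.v *)
From mathcomp Require Import all_boot all_order all_algebra.
From mathcomp Require Import all_classical all_reals all_analysis.

Set Implicit Arguments.
Unset Strict Implicit.
Unset Printing Implicit Defensive.

Import Order.TTheory GRing.Theory Num.Theory.
Import numFieldNormedType.Exports.

Local Open Scope classical_set_scope.
Local Open Scope ring_scope.

Definition Omega (R : realType) : set R := `[-1, 1].

(* Derivative relative to the closed interval [-1, 1]: the two-sided derivative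
   at interior points, the one-sided derivative at -1 and 1. The values of f
   outside [-1, 1] are irrelevant; [ddx f x] is meaningful when
   [derivable_in f x] holds. *)
Definition derivable_in (R : realType) (f : R -> R) (x : R) : Prop :=
  cvg ((f y - f x) / (y - x) @[y --> within (@Omega R) x^']).

Definition ddx (R : realType) (f : R -> R) (x : R) : R :=
  lim ((f y - f x) / (y - x) @[y --> within (@Omega R) x^']).

Definition C1 (R : realType) (f : R -> R) : Prop :=
  (forall x, Omega x -> derivable_in f x) /\ {within @Omega R, continuous (ddx f)}.

Definition C2 (R : realType) (f : R -> R) : Prop := C1 f /\ C1 (ddx f).

Definition n0 (R : realType) (m0 : R) (psi : R -> R) (x : R) : R :=
  m0 * expR (psi x) / \int[lebesgue_measure]_(y in @Omega R) expR (psi y).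

Definition p0 (R : realType) (m0 : R) (psi : R -> R) (x : R) : R :=
  m0 * expR (- psi x) / \int[lebesgue_measure]_(y in @Omega R) expR (- psi y).

Definition delta0 (R : realType) (m0 : R) (psi : R -> R) (x : R) : R :=
  n0 m0 psi x - p0 m0 psi x.

Definition eta0 (R : realType) (m0 : R) (psi : R -> R) (x : R) : R :=
  n0 m0 psi x + p0 m0 psi x.

(* [phi1] is phi_0(1), and phi_0(-1) = - phi1. *)
Record steady_state (R : realType) (eps gamma m0 phi1 : R) (psi : R -> R) : Prop :=
  SteadyState {
    steady_C2 : C2 psi;
    steady_eq : forall x, -1 < x < 1 ->
      eps * ddx (ddx psi) x = n0 m0 psi x - p0 m0 psi x;
    steady_bcr : psi 1 + gamma * ddx psi 1 = phi1;
    steady_bcl : psi (-1) - gamma * ddx psi (-1) = - phi1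
  }.

(* Space-time functions are written u x t. *)
Definition dX (R : realType) (u : R -> R -> R) (x t : R) : R :=
  ddx (fun y => u y t) x.

Definition dT (R : realType) (u : R -> R -> R) (x t : R) : R :=
  derive1 (u x) t.

Definition continuous_ST (R : realType) (u : R -> R -> R) : Prop :=
  {within @Omega R `*` `]0, +oo[, continuous (fun z : R * R => u z.1 z.2)}.

(* u, u_x, u_xx exist and are jointly continuous on [-1, 1] x (0, +oo). *)
Record regular_x (R : realType) (u : R -> R -> R) : Prop := RegularX {
  regular_cont : continuous_ST u;
  regular_ex_x : forall x t, Omega x -> 0 < t -> derivable_in (u ^~ t) x;
  regular_cont_x : continuous_ST (dX u);
  regular_ex_xx : forall x t, Omega x -> 0 < t -> derivable_in (dX u ^~ t) x;
  regular_cont_xx : continuous_ST (dX (dX u))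
}.

Record regular_xt (R : realType) (u : R -> R -> R) : Prop := RegularXT {
  regular_xt_x : regular_x u;
  regular_ex_t : forall x t, Omega x -> 0 < t -> derivable (u x) t 1;
  regular_cont_t : continuous_ST (dT u)
}.

(* u(., 0) is in L^2(-1, 1) and u(., t) tends to it in L^2(-1, 1) as t -> 0+. *)
Record L2_initial (R : realType) (u : R -> R -> R) : Prop := L2Initial {
  L2_meas : measurable_fun (@Omega R) (u ^~ 0);
  L2_fin : (@lebesgue_measure R).-integrable (@Omega R)
             (fun x => ((u x 0) ^+ 2)%:E);
  L2_cvg : (\int[@lebesgue_measure R]_(x in @Omega R) ((u x t - u x 0) ^+ 2)%:E)%E
             @[t --> 0^'+] --> 0%E
}.

Record LP_solution (R : realType) (eps gamma m0 : R) (psi : R -> R)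
    (delta eta phi : R -> R -> R) : Prop := LPSolution {
  LP_delta_reg : regular_xt delta;
  LP_eta_reg : regular_xt eta;
  LP_phi_reg : regular_x phi;
  LP_delta_init : L2_initial delta;
  LP_eta_init : L2_initial eta;
  LP_delta_eq : forall x t, -1 < x < 1 -> 0 < t ->
    dT delta x t = dX (dX delta) x t
      - ddx (fun y => eta0 m0 psi y * dX phi y t) x
      - ddx (fun y => eta y t * ddx psi y) x;
  LP_eta_eq : forall x t, -1 < x < 1 -> 0 < t ->
    dT eta x t = dX (dX eta) x t
      - ddx (fun y => delta0 m0 psi y * dX phi y t) x
      - ddx (fun y => delta y t * ddx psi y) x;
  LP_phi_eq : forall x t, -1 < x < 1 -> 0 < t ->
    eps * dX (dX phi) x t = delta x t;
  LP_delta_bc : forall x t, x = -1 \/ x = 1 -> 0 < t ->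
    dX delta x t - eta0 m0 psi x * dX phi x t - eta x t * ddx psi x = 0;
  LP_eta_bc : forall x t, x = -1 \/ x = 1 -> 0 < t ->
    dX eta x t - delta0 m0 psi x * dX phi x t - delta x t * ddx psi x = 0;
  LP_phi_bcr : forall t, 0 < t -> phi 1 t + gamma * dX phi 1 t = 0;
  LP_phi_bcl : forall t, 0 < t -> phi (-1) t - gamma * dX phi (-1) t = 0
}.

(* For u = delta, eta: [primitive u] is D, H; [mean_primitive u] is d, h;
   [centered_primitive u] is D - d, H - h. *)
Definition primitive (R : realType) (u : R -> R -> R) (x t : R) : R :=
  \int[lebesgue_measure]_(s in `[-1, x]) u s t.

Definition mean_primitive (R : realType) (u : R -> R -> R) (t : R) : R :=
  2^-1 * \int[lebesgue_measure]_(x in @Omega R) primitive u x t.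

Definition centered_primitive (R : realType) (u : R -> R -> R) (x t : R) : R :=
  primitive u x t - mean_primitive u t.

Definition energy (R : realType) (delta eta : R -> R -> R) (t : R) : R :=
  2^-1 * (\int[lebesgue_measure]_(x in @Omega R)
            (centered_primitive delta x t ^+ 2 + centered_primitive eta x t ^+ 2))
  + mean_primitive delta t ^+ 2 + mean_primitive eta t ^+ 2.

Definition M (R : realType) (m0 phi1 : R) : R :=
  Num.sqrt (m0 / (2 * expR phi1)).

Definition K0 (R : realType) (phi1 : R) : R :=
  sup [set `|expR y - 1| / `|y| | y in [set y : R | 0 < `|y| <= phi1]].

(* Main.v *)
Require Import Defs.
From mathcomp Require Import all_boot all_order all_algebra.
From mathcomp Require Import all_classical all_reals all_analysis.
From mathcomp Require Import measurable_realfun ring lra.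

(** The proof is an energy estimate for the primitives D, H of the two
densities.  Centering only splits off the means, so that the energy is
1/2 int (D^2 + H^2) ([energyE]).  Integrating the two transport equations from
-1 to x and using the no-flux conditions gives
   D_t = delta_x - eta0 phi_x - eta psi_x,
   H_t = eta_x - delta0 phi_x - delta psi_x
([flux_identity]); at x = 1 this is conservation of mass, so D and H vanish at
both end points.  Integrating Poisson's equation, the Robin conditions fix the
constant of integration: eps phi_x = D - s d with s = 1 / (1 + gamma) and d the
mean of D ([field_formula]).

The key step is [dissipation].  From the integrand D D_t + H H_t of the energy
rate one subtracts the derivative of
   Q = D delta + H eta - D H psi_x + s d psi_x H,
whose integral is zero because Q vanishes at both ends.  All coupling terms
containing psi_xx cancel, since eps psi_xx = delta0, and what is left is
   - delta^2 - eta^2 - eta0 D (D - s d) / eps - s d psi_x eta.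
Let c0 = min eta0.  The part c0 D (D - s d) of the third term has integral at
least 2 c0 gamma s d^2: this is where gamma > 0 helps.  Completing squares, the
rest costs at most half of delta^2 + eta^2 and a multiple of s^2 d^2 psi_x^2,
because the first integral eps/2 psi_x^2 - eta0 = const of the steady equation
gives eta0 - c0 <= eps/2 psi_x^2.  Hence everything reduces to comparing
eps int psi_x^2 with c0 gamma.

Both quantities are controlled by testing the steady equation with a
nondecreasing function w of psi: as delta0 is an increasing function of psi with
zero mean, int delta0 w(psi) >= 0, whence
   int psi_x^2 w'(psi) <= [psi_x w(psi)]
([monotone_test_le]), and the Robin conditions bound the right-hand side.  For
w(z) = z this gives int psi_x^2 <= phi1^2 / (2 gamma); for w a cubed positive
part it gives |psi| <= phi1, hence c0 >= m0 exp(- phi1).  Since K0 >= 1, the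
lower bound on gamma / sqrt eps implies eps phi1^2 <= gamma^2 m0 exp(- phi1)
([gamma_sqr_ge]), and with it the terms in d^2 add up to something nonpositive.

There remains dE/dt <= - 1/2 int (delta^2 + eta^2) <= - E / 4 by Poincare's
inequality, so that E exp(t/4) is nonincreasing for t > 0.  The L^2 continuity
of the densities at t = 0 makes D and H converge uniformly as t -> 0+
([primitive_gap]), which carries the bound, and the neutrality of the initial
data, across t = 0. *)

Set Implicit Arguments.
Unset Strict Implicit.
Unset Printing Implicit Defensive.

Import Order.TTheory GRing.Theory Num.Theory.
Import numFieldNormedType.Exports.

Local Open Scope classical_set_scope.
Local Open Scope ring_scope.

Local Notation continuous_on_Omega f := {within @Omega _, continuous f}.
Local Notation mu := lebesgue_measure.

(** * Calculus on the closed interval *)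

Section Calculus.
Context {R : realType}.
Implicit Types (f g F G : R -> R) (x y : R).

Lemma OmegaE x : Omega x = (-1 <= x <= 1) :> Prop.
Proof. by rewrite /Omega /= in_itv. Qed.

Lemma Omega_oo x : -1 < x < 1 -> Omega x.
Proof. by rewrite OmegaE => /andP[/ltW -> /ltW ->]. Qed.

Lemma measurable_Omega : measurable (@Omega R : set (measurableTypeR R)).
Proof. exact: measurable_itv. Qed.
Hint Resolve measurable_Omega : core.

Lemma cont_cst (c : R) : continuous_on_Omega (fun _ : R => c).
Proof. by move=> x; exact: cvg_cst. Qed.

Lemma contD f g : continuous_on_Omega f -> continuous_on_Omega g ->
  continuous_on_Omega (fun x => f x + g x).
Proof. by move=> cf cg x; apply: cvgD; [exact: cf|exact: cg]. Qed.

Lemma contN f : continuous_on_Omega f -> continuous_on_Omega (fun x => - f x).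
Proof. by move=> cf x; apply: cvgN; exact: cf. Qed.

Lemma contM f g : continuous_on_Omega f -> continuous_on_Omega g ->
  continuous_on_Omega (fun x => f x * g x).
Proof. by move=> cf cg x; apply: cvgM; [exact: cf|exact: cg]. Qed.

Lemma contB f g : continuous_on_Omega f -> continuous_on_Omega g ->
  continuous_on_Omega (fun x => f x - g x).
Proof. by move=> cf cg; apply: contD => //; exact: contN. Qed.

Lemma contX f n : continuous_on_Omega f -> continuous_on_Omega (fun x => f x ^+ n).
Proof.
move=> cf; elim: n => [|n IH]; first exact: cont_cst.
by under eq_fun do rewrite exprS; exact: contM.
Qed.

Lemma cont_comp (w : R -> R) f : continuous w -> continuous_on_Omega f ->
  continuous_on_Omega (w \o f).
Proof. by move=> cw cf x; exact: (continuous_comp (cf x) (cw (f x))). Qed.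

Lemma cont_integrable f : continuous_on_Omega f ->
  mu.-integrable (@Omega R) (EFin \o f).
Proof. by apply: continuous_compact_integrable; exact: segment_compact. Qed.

(** Differentiability is only asked inside (-1, 1), with continuity up to the
boundary: this is stable under products and composition, it follows from the
one-sided notion of derivative at the end points, and it is all that the
fundamental theorem of calculus uses. *)
Definition antider f g :=
  continuous_on_Omega f /\ forall x, -1 < x < 1 -> is_derive x 1 f (g x).

Lemma antider_cont f g : antider f g -> continuous_on_Omega f.
Proof. by case. Qed.

Lemma antiderE f g f' : (forall x, -1 < x < 1 -> g x = f' x) ->
  antider f g -> antider f f'.
Proof. by move=> E [cf df]; split => // x xI; rewrite -E //; exact: df. Qed.

Lemma antider_cst (c : R) : antider (fun=> c) (fun=> 0).
Proof. by split; [exact: cont_cst|move=> x _; exact: is_derive_cst]. Qed.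

Lemma antiderD f g f' g' : antider f f' -> antider g g' ->
  antider (fun x => f x + g x) (fun x => f' x + g' x).
Proof.
move=> [cf df] [cg dg]; split; first exact: contD.
by move=> x xI; apply: is_deriveD; [exact: df|exact: dg].
Qed.

Lemma antiderN f f' : antider f f' -> antider (fun x => - f x) (fun x => - f' x).
Proof.
move=> [cf df]; split; first exact: contN.
by move=> x xI; apply: is_deriveN; exact: df.
Qed.

Lemma antiderB f g f' g' : antider f f' -> antider g g' ->
  antider (fun x => f x - g x) (fun x => f' x - g' x).
Proof. by move=> df dg; apply: antiderD => //; exact: antiderN. Qed.

Lemma antiderM f g f' g' : antider f f' -> antider g g' ->
  antider (fun x => f x * g x) (fun x => f' x * g x + f x * g' x).
Proof.
move=> [cf df] [cg dg]; split; first exact: contM.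
move=> x xI; have := df x xI; have := dg x xI => dgx dfx.
by apply: is_derive_eq; rewrite /GRing.scale /= addrC mulrC.
Qed.

Lemma antiderZ (c : R) f f' : antider f f' ->
  antider (fun x => c * f x) (fun x => c * f' x).
Proof.
move=> df; apply: antiderE (antiderM (antider_cst c) df) => x _.
by rewrite mul0r add0r.
Qed.

Lemma antider_comp (w w' : R -> R) f f' : (forall z : R, is_derive z 1 w (w' z)) ->
  antider f f' -> antider (fun x => w (f x)) (fun x => f' x * w' (f x)).
Proof.
move=> dw [cf df]; split.
  apply: (@cont_comp w) cf => z; have [dz _] := dw z.
  exact/differentiable_continuous/derivable1_diffP.
move=> x xI; have dfx := df x xI.
by rewrite mulrC; exact: (@is_derive1_comp _ w f x _ _ (dw _) dfx).
Qed.

Lemma FTC f g x : antider f g -> continuous_on_Omega g -> Omega x ->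
  \int[mu]_(y in `[-1, x]) g y = f x - f (-1).
Proof.
move=> [cf df] cg; rewrite OmegaE => /andP[]; rewrite le_eqVlt.
case/predU1P => [<- _|x1 x2]; first by rewrite set_itv1 Rintegral_set1 subrr.
have sub : `[-1, x] `<=` @Omega R.
  by move=> y; rewrite /Omega /= !in_itv /= => /andP[-> /le_trans->].
rewrite /Rintegral (continuous_FTC2 x1 (F := f)) //.
- exact: continuous_subspaceW cg.
- have /(continuous_within_itvP _ x1)[c1 c2 c3] := continuous_subspaceW sub cf.
  split => // y; rewrite in_itv /= => /andP[y1 y2].
  by have [] // := df y _; rewrite y1 (lt_le_trans y2 x2).
- move=> y; rewrite in_itv /= => /andP[y1 y2].
  by rewrite derive1E; have [] // := df y _; rewrite y1 (lt_le_trans y2 x2).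
Qed.

Lemma FTC_Omega f g : antider f g -> continuous_on_Omega g ->
  \int[mu]_(y in @Omega R) g y = f 1 - f (-1).
Proof. by move=> *; apply: FTC => //; rewrite OmegaE lexx andbT; lra. Qed.

Lemma antider0_cst f x y : antider f (fun=> 0) -> Omega x -> Omega y -> f x = f y.
Proof.
move=> df; suff H z : Omega z -> f z = f (-1) by move=> /H -> /H ->.
move=> Oz; apply/eqP; rewrite -subr_eq0 -(FTC df (@cont_cst 0) Oz).
by rewrite Rintegral_cst// mul0r.
Qed.

Lemma integrable_itv f x : Omega x -> mu.-integrable (@Omega R) (EFin \o f) ->
  mu.-integrable `[-1, x] (EFin \o f).
Proof.
rewrite OmegaE => /andP[_ x1]; apply: integrableS => //.
by move=> y; rewrite /Omega /= !in_itv /= => /andP[-> /le_trans->].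
Qed.

Lemma cont_primitive f : mu.-integrable (@Omega R) (EFin \o f) ->
  continuous_on_Omega (fun x => \int[mu]_(y in `[-1, x]) f y).
Proof. by apply: parameterized_integral_continuous; rewrite -subr_ge0; lra. Qed.

Lemma antider_primitive f : continuous_on_Omega f ->
  antider (fun x => \int[mu]_(y in `[-1, x]) f y) f.
Proof.
move=> cf; split; first exact/cont_primitive/cont_integrable.
move=> x /andP[x1 x2].
have fi := cont_integrable cf.
have cfx : {for x, continuous f}.
  have [c _ _] := proj1 (continuous_within_itvP f (lt_trans x1 x2)) cf.
  by apply: c; rewrite in_itv /= x1.
have [d1 d2] := continuous_FTC1_closed x2 fi x1 cfx.
by apply: DeriveDef; [exact: d1|rewrite -derive1E; exact: d2].
Qed.

End Calculus.

(** * One-sided derivatives and the Poincare inequality *)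

Section DerivativeOnOmega.
Context {R : realType}.
Implicit Types (f g F G : R -> R) (x y : R).

Local Notation quot f x := (fun y => (f y - f x) / (y - x)).

Lemma derivable_in_cvg f x : derivable_in f x ->
  quot f x y @[y --> within (@Omega R) x^'] --> ddx f x.
Proof. by []. Qed.

Lemma is_derive_congr (f : R -> R) (x a b : R) :
  is_derive x 1 f a -> a = b -> is_derive x 1 f b.
Proof. by move=> ? <-. Qed.

(** Inside the interval the one-sided restriction is invisible, so [ddx] is there
the ordinary derivative. *)
Lemma within_Omega_dnbhs x : -1 < x < 1 -> within (@Omega R) x^' = x^'.
Proof.
move=> xI; apply/seteqP; split => V /= [e e0 HV]; last first.
  by exists e => // y /= ye yx _; exact: HV.
have xoo : x \in `]-1, 1[ by rewrite in_itv.
case: (near_in_itvoo xoo) => e' e'0 HO; exists (Num.min e e').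
  by rewrite /= lt_min e0.
move=> y /=; rewrite lt_min => /andP[y1 y2] yx; apply: HV => //.
by have := HO _ y2; rewrite in_itv; exact: Omega_oo.
Qed.

Lemma is_derive_quot f x a :
  is_derive x 1 f a <-> quot f x y @[y --> x^'] --> a.
Proof.
rewrite is_derive1_caratheodory; split.
  move=> [g [fg cg <-]]; have /continuous_withinNx := cg; apply: cvg_trans.
  apply: near_eq_cvg; exists 1 => //= y _ yx.
  by rewrite fg mulfK// subr_eq0.
move=> H; exists (fun y => if y == x then a else quot f x y); split => //.
- move=> y; case: eqP => [->|/eqP yx]; first by rewrite !subrr mulr0.
  by rewrite divfK// subr_eq0.
- apply/continuous_withinNx; rewrite eqxx.
  apply: cvg_trans H; apply: near_eq_cvg; exists 1 => //= y _ /negbTE.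
  by move=> ->.
- by rewrite eqxx.
Qed.

Lemma ddx_interior f x : -1 < x < 1 -> derivable_in f x ->
  is_derive x 1 f (ddx f x).
Proof.
move=> xI /derivable_in_cvg df; apply/is_derive_quot.
by rewrite -within_Omega_dnbhs.
Qed.

Lemma is_derive_ddx f x a : -1 < x < 1 -> is_derive x 1 f a -> ddx f x = a.
Proof.
move=> xI /is_derive_quot H; rewrite /ddx within_Omega_dnbhs//.
exact: cvg_lim.
Qed.

Lemma derivable_in_continuous f : (forall x, Omega x -> derivable_in f x) ->
  continuous_on_Omega f.
Proof.
move=> df; apply/subspace_continuousP => x Ox.
have H : f y @[y --> within (@Omega R) x^'] --> f x.
  have c : (f x + quot f x y * (y - x)) @[y --> within (@Omega R) x^'] -->
      f x + ddx f x * (x - x).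
    apply: cvgD; first exact: cvg_cst.
    apply: cvgM; first exact: (derivable_in_cvg (df _ Ox)).
    apply: cvgB; last exact: cvg_cst.
    apply: cvg_trans (@cvg_id _ (nbhs x)) => V /= [e e0 HV].
    by exists e => // y /= ye yx _; exact: HV.
  rewrite subrr mulr0 addr0 in c; apply: cvg_trans c.
  apply: near_eq_cvg; exists 1 => //= y _ yx _.
  by rewrite divfK ?subr_eq0// subrKC.
apply/cvgrPdist_lt => e e0; move/cvgrPdist_lt : H => /(_ _ e0)[r r0 Hr].
exists r => //= y yr Oy; have [->|yx] := eqVneq y x; first by rewrite subrr normr0.
exact: Hr.
Qed.

Lemma antider_ddx f : C1 f -> antider f (ddx f).
Proof.
move=> [df cf]; split; first exact: derivable_in_continuous.
by move=> x xI; apply: ddx_interior => //; exact/df/Omega_oo.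
Qed.

Lemma integrableR_add D f g : measurable D -> mu.-integrable D (EFin \o f) ->
  mu.-integrable D (EFin \o g) -> mu.-integrable D (EFin \o (fun x : R => f x + g x)).
Proof. by move=> mD fi gi; exact: (integrableD mD fi gi). Qed.

Lemma integrableR_sub D f g : measurable D -> mu.-integrable D (EFin \o f) ->
  mu.-integrable D (EFin \o g) -> mu.-integrable D (EFin \o (fun x : R => f x - g x)).
Proof. by move=> mD fi gi; exact: (integrableB mD fi gi). Qed.

Lemma integrableR_scale D (c : R) f : measurable D -> mu.-integrable D (EFin \o f) ->
  mu.-integrable D (EFin \o (fun x : R => c * f x)).
Proof. by move=> mD fi; exact: (integrableZl mD c fi). Qed.

Lemma fine_measure_itv x : -1 <= x ->
  fine (@lebesgue_measure R `[-1, x]) = x + 1.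
Proof.
rewrite le_eqVlt => /predU1P[<-|x1].
  by rewrite set_itv1 lebesgue_measure_set1 addNr.
by rewrite lebesgue_measure_itv/= lte_fin x1 /= opprK.
Qed.

(** The interval has finite measure: |g| <= 1 + g^2. *)
Lemma L2_integrable g : measurable_fun (@Omega R) g ->
  mu.-integrable (@Omega R) (fun x => ((g x) ^+ 2)%:E) ->
  mu.-integrable (@Omega R) (EFin \o g).
Proof.
move=> mg ig.
have i1 : mu.-integrable (@Omega R) (EFin \o (fun x => 1 + g x ^+ 2)).
  have i0 : mu.-integrable (@Omega R) (EFin \o (fun=> 1)).
    exact/cont_integrable/cont_cst.
  by apply: integrableR_add => //; exact: measurable_Omega.
apply: le_integrable i1; first exact: measurable_Omega.
  exact/measurable_EFinP.
move=> x _; rewrite /= lee_fin [leRHS]ger0_norm; last first.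
  by rewrite addr_ge0// sqr_ge0.
have := sqr_ge0 (`|g x| - 1); rewrite sqrrB expr1n mulr1 real_normK ?num_real//.
by have := normr_ge0 (g x); nra.
Qed.

(** Cauchy-Schwarz on an interval of length at most 2, obtained by integrating
(g - c)^2 >= 0 with c half of the integral of g. *)
Lemma sqr_integral_le g x : Omega x ->
  mu.-integrable (@Omega R) (EFin \o g) ->
  mu.-integrable (@Omega R) (EFin \o (fun y => g y ^+ 2)) ->
  (\int[mu]_(y in `[-1, x]) g y) ^+ 2 <= 2 * \int[mu]_(y in @Omega R) (g y ^+ 2).
Proof.
move=> Ox ig ig2; have := Ox; rewrite OmegaE => /andP[x1 x2].
set I := \int[mu]_(y in `[-1, x]) g y.
(* With this c the term c^2 (x + 1) costs at most half of I^2, as x + 1 <= 2. *)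
pose c := I / 2.
have ic : mu.-integrable `[-1, x] (EFin \o (fun=> c ^+ 2)).
  exact/(integrable_itv Ox)/cont_integrable/cont_cst.
have igx := integrable_itv Ox ig.
have igc : mu.-integrable `[-1, x] (EFin \o (fun y => 2 * c * g y)).
  exact: integrableR_scale.
have H1 : \int[mu]_(y in `[-1, x]) (2 * c * g y - c ^+ 2) <=
    \int[mu]_(y in `[-1, x]) (g y ^+ 2).
  apply: le_Rintegral => //; last 2 first.
  - exact: (integrable_itv Ox ig2).
  - by move=> y _; have := sqr_ge0 (g y - c); nra.
  exact: integrableR_sub.
have H2 : \int[mu]_(y in `[-1, x]) (g y ^+ 2) <= \int[mu]_(y in @Omega R) (g y ^+ 2).
  rewrite /Rintegral fine_le//.
  - exact: (integrable_fin_num _ (integrable_itv Ox ig2)).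
  - apply: integrable_fin_num => //; exact: measurable_Omega.
  apply: ge0_subset_integral => //; first exact: measurable_Omega.
  - by case/integrableP : ig2.
  - by move=> y _; rewrite lee_fin sqr_ge0.
  - by move=> y; rewrite /Omega /= !in_itv /= => /andP[-> /le_trans->].
move: H1; rewrite RintegralB// RintegralZl// Rintegral_cst//.
rewrite fine_measure_itv// -/I /c.
move: H2; set J := \int[mu]_(y in `[-1, x]) _; set K := Rintegral _ _ _.
by have := sqr_ge0 I; nra.
Qed.

Lemma poincare f f' x : antider f f' -> continuous_on_Omega f' -> f (-1) = 0 ->
  Omega x -> f x ^+ 2 <= 2 * \int[mu]_(y in @Omega R) (f' y ^+ 2).
Proof.
move=> df cf f0 Ox; rewrite -[f x]subr0 -f0 -(FTC df cf Ox).
by apply: sqr_integral_le => //; apply: cont_integrable => //; exact: contX.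
Qed.

End DerivativeOnOmega.

(** * Integrals of continuous functions and the squared positive part *)

Section Integrals.
Context {R : realType}.
Implicit Types (f g : R -> R).

Lemma cont_le_integral f g : continuous_on_Omega f -> continuous_on_Omega g ->
  (forall x, Omega x -> f x <= g x) ->
  \int[mu]_(x in @Omega R) f x <= \int[mu]_(x in @Omega R) g x.
Proof.
move=> cf cg H.
exact: (le_Rintegral (@measurable_Omega R) (cont_integrable cf) (cont_integrable cg) H).
Qed.

Lemma cont_integralD f g : continuous_on_Omega f -> continuous_on_Omega g ->
  \int[mu]_(x in @Omega R) (f x + g x) =
  \int[mu]_(x in @Omega R) f x + \int[mu]_(x in @Omega R) g x.
Proof.
move=> cf cg.
exact: (RintegralD (@measurable_Omega R) (cont_integrable cf) (cont_integrable cg)).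
Qed.

Lemma cont_integralZ (c : R) f : continuous_on_Omega f ->
  \int[mu]_(x in @Omega R) (c * f x) = c * \int[mu]_(x in @Omega R) f x.
Proof.
by move=> cf; exact: (RintegralZl _ (@measurable_Omega R) (cont_integrable cf)).
Qed.

Lemma integral_cst_Omega (c : R) : \int[mu]_(x in @Omega R) c = c * 2.
Proof.
rewrite Rintegral_cst; last exact: measurable_Omega.
by rewrite fine_measure_itv //; rewrite -subr_ge0; lra.
Qed.

Lemma eq_Omega_integral f g : (forall x, Omega x -> f x = g x) ->
  \int[mu]_(x in @Omega R) f x = \int[mu]_(x in @Omega R) g x.
Proof. by move=> fg; apply: eq_Rintegral => x /set_mem; exact: fg. Qed.

Lemma cont_integral_gt0 f : continuous_on_Omega f ->
  (forall x, Omega x -> 0 < f x) -> 0 < \int[mu]_(x in @Omega R) f x.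
Proof.
move=> cf f0; have le11 : (-1 : R) <= 1 by lra.
have [c Oc cmin] := EVT_min le11 cf.
apply: (@lt_le_trans _ _ (f c * 2)); first by rewrite mulr_gt0// f0.
by rewrite -integral_cst_Omega; apply: cont_le_integral => //; exact: cont_cst.
Qed.

(** A quadratic bound on the remainder determines the derivative; for the squared
positive part this bound is a polynomial inequality, valid across 0 as well. *)
Lemma is_derive_quadratic f (z a K : R) :
  (forall y, `|f y - f z - a * (y - z)| <= K * (y - z) ^+ 2) ->
  is_derive z 1 f a.
Proof.
move=> H; apply/is_derive_quot.
have K_ge0 : 0 <= K.
  have := le_trans (normr_ge0 _) (H (z + 1)).
  by rewrite (addrC z) addrK expr1n mulr1.
have K1 : 0 < K + 1 by lra.
apply/cvgrPdist_lt => e e0; exists (e / (K + 1)); first by rewrite /= divr_gt0.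
move=> y /=; rewrite distrC ltr_pdivlMr// => yz /negbTE y_neq.
have yz0 : y - z != 0 by rewrite subr_eq0 y_neq.
rewrite distrC (_ : _ - a = (f y - f z - a * (y - z)) / (y - z)); last by field.
rewrite normf_div ltr_pdivrMr ?normr_gt0//.
apply: le_lt_trans (H y) _; rewrite -real_normK ?num_real// expr2 mulrA.
rewrite ltr_pM2r ?normr_gt0//; apply: le_lt_trans yz.
by have := normr_ge0 (y - z); nra.
Qed.

Definition pos (z : R) := Num.max z 0.

Lemma continuous_pos : continuous (pos : R -> R).
Proof.
move=> z; apply/cvgrPdist_lt => e e0; exists e => // y /=.
apply: le_lt_trans; rewrite /pos.
by case: (leP z 0) => z0; case: (leP y 0) => y0; rewrite !ler_norml;
  (have := ler_norm (z - y)); (have := ler_norm (y - z)); rewrite (distrC y) => *;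
  apply/andP; split; lra.
Qed.

Lemma is_derive_pos_sqr (z : R) :
  is_derive z 1 (fun u => pos u ^+ 2) (2 * pos z).
Proof.
apply: (@is_derive_quadratic _ _ _ 1) => y; rewrite ler_norml /pos.
have yz := sqr_ge0 (y - z).
by case: (leP y 0) => y0; case: (leP z 0) => z0; apply/andP; split; nra.
Qed.

End Integrals.

(** * A priori bounds for the Poisson-Boltzmann equation *)

Section SteadyState.
Context {R : realType}.
Variables (A B eps : R) (f f' : R -> R).
Hypotheses (A0 : 0 < A) (B0 : 0 < B) (eps0 : 0 < eps).
Let charge x := A * expR (f x) - B * expR (- f x).
Hypothesis df : antider f f'.
Hypothesis df' : antider f' (fun x => eps^-1 * charge x).

Lemma cont_expR (g : R -> R) : continuous_on_Omega g ->
  continuous_on_Omega (fun x => expR (g x)).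
Proof. by apply: cont_comp; exact: continuous_expR. Qed.

Lemma cont_charge : continuous_on_Omega charge.
Proof.
have [cf _] := df.
apply: contB; apply: contM; try exact: cont_cst; apply: cont_expR => //.
exact: contN.
Qed.

Hypothesis neutral : f' 1 = f' (-1).

(** Multiply the equation by w(f) and integrate by parts.  The charge is an
increasing function of f that vanishes at the value k with A e^k = B e^(-k), so
charge * (w(f) - w(k)) >= 0; neutrality makes the constant w(k) harmless. *)
Lemma monotone_test_le (w w' : R -> R) : {homo w : x y / x <= y} ->
  (forall z : R, is_derive z 1 w (w' z)) -> continuous w' ->
  \int[mu]_(x in @Omega R) (f' x ^+ 2 * w' (f x)) <=
  f' 1 * w (f 1) - f' (-1) * w (f (-1)).
Proof.
move=> wmono dw cw'.
have [cf _] := df; have [cf' _] := df'.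
have cw : continuous w.
  by move=> z; have [dz _] := dw z; exact/differentiable_continuous/derivable1_diffP.
pose f2 x := eps^-1 * charge x.
have cf2 : continuous_on_Omega f2 by apply: contM; [exact: cont_cst|exact: cont_charge].
have dq := antiderM df' (antider_comp dw df).
have cwf := cont_comp cw cf.
have cwf' := cont_comp cw' cf.
have cq1 : continuous_on_Omega (fun x => f' x ^+ 2 * w' (f x)).
  by apply: contM => //; exact: contX.
have cq : continuous_on_Omega (fun x => f2 x * w (f x) + f' x * (f' x * w' (f x))).
  apply: contD; first exact: contM.
  by apply: contM => //; exact: contM.
rewrite -(FTC_Omega dq cq).
pose k := ln (B / A) / 2.
have kP z : (A * expR z - B * expR (- z)) * (w z - w k) >= 0.
  have e2k : expR k * expR k = B / A.
    by rewrite -expRD /k -splitr lnK// posrE divr_gt0.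
  have AB : A * expR k = B * expR (- k).
    rewrite expRN; apply: (mulIf (lt0r_neq0 (expR_gt0 k))).
    by rewrite mulfVK ?lt0r_neq0 ?expR_gt0// -mulrA e2k mulrCA divff ?mulr1 ?lt0r_neq0.
  have [zk|/ltW zk] := leP z k.
    rewrite mulr_le0// ?subr_le0 ?wmono//.
    apply: (@le_trans _ _ (A * expR k)); first by rewrite ler_pM2l// ler_expR.
    by rewrite AB ler_pM2l// ler_expR lerN2.
  rewrite mulr_ge0// ?subr_ge0 ?wmono//.
  apply: (@le_trans _ _ (A * expR k)); last by rewrite ler_pM2l// ler_expR.
  by rewrite AB ler_pM2l// ler_expR lerN2.
have E : \int[mu]_(x in @Omega R) (f' x ^+ 2 * w' (f x) + w k * f2 x) =
    \int[mu]_(x in @Omega R) (f' x ^+ 2 * w' (f x)).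
  rewrite cont_integralD//; last by apply: contM => //; exact: cont_cst.
  by rewrite cont_integralZ// (FTC_Omega df' cf2) neutral subrr mulr0 addr0.
rewrite -E; apply: cont_le_integral => //.
  by apply: contD => //; apply: contM => //; exact: cont_cst.
move=> x _; have := kP (f x); rewrite -/(charge x).
have : 0 < eps^-1 by rewrite invr_gt0.
move=> e0 /(mulr_ge0 (ltW e0)); rewrite /f2 -/(charge x).
by move: (charge x) (w (f x)) (w k) => a b c; rewrite expr2; lra.
Qed.

Variables (gamma b1 b2 : R).
Hypothesis gamma0 : 0 < gamma.
Hypothesis bc1 : f 1 + gamma * f' 1 = b1.
Hypothesis bc2 : f (-1) - gamma * f' (-1) = b2.

(** The Robin conditions turn the boundary term of [monotone_test_le] for
w(z) = z into (b1 - f) f / gamma at 1, and its mirror image at -1; each is at most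
b1^2 / (4 gamma). *)
Lemma grad_sqr_le : b2 = - b1 ->
  \int[mu]_(x in @Omega R) (f' x ^+ 2) <= b1 ^+ 2 / (2 * gamma).
Proof.
move=> b12.
have := @monotone_test_le id (fun=> 1) (fun _ _ => id) (fun z => is_derive_id z 1)
  (@cst_continuous _ _ (1 : R)).
under eq_Rintegral do rewrite mulr1.
move=> /le_trans; apply.
have -> : f' 1 = (b1 - f 1) / gamma by rewrite -bc1; field; exact: lt0r_neq0.
have -> : f' (-1) = (f (-1) + b1) / gamma.
  by rewrite -[b1]opprK -b12 -bc2; field; exact: lt0r_neq0.
rewrite -subr_ge0.
have -> : b1 ^+ 2 / (2 * gamma) -
  ((b1 - f 1) / gamma * f 1 - (f (-1) + b1) / gamma * f (-1)) =
  ((f 1 - b1 / 2) ^+ 2 + (f (-1) + b1 / 2) ^+ 2) / gamma.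
  by field; exact: lt0r_neq0.
by apply: divr_ge0 (ltW gamma0); rewrite addr_ge0 ?sqr_ge0.
Qed.

(** Test with w = 4/3 (z - c)_+^3: both boundary terms are nonpositive, so
int f'^2 w'(f) = 0.  Since w' = W'^2 for W = (z - c)_+^2, this integral is that
of the squared derivative of W(f), which is therefore constant; it vanishes at
-1, hence everywhere. *)
Lemma maximum_principle c x : b1 <= c -> b2 <= c -> Omega x -> f x <= c.
Proof.
move=> b1c b2c Ox.
pose w z := 4 / 3 * (pos (z - c) ^+ 2 * (z - c)).
pose w' z := (2 * pos (z - c)) ^+ 2.
pose W z := pos (z - c) ^+ 2.
have dshift (z : R) : is_derive z 1 (fun u : R => u - c) 1.
  by apply: is_derive_eq; rewrite oppr0 addr0.
have dW (z : R) : is_derive z 1 W (2 * pos (z - c)).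
  rewrite -[2 * _]mulr1.
  exact: (@is_derive1_comp _ (fun u => pos u ^+ 2) (fun u => u - c) _ _ _
    (is_derive_pos_sqr _) (dshift z)).
have dw (z : R) : is_derive z 1 w (w' z).
  have dWz := dW z.
  have dsz := dshift z.
  have : is_derive z 1 (fun u => W u * (u - c)) (3 * W z).
    apply: is_derive_eq; rewrite /GRing.scale /= mulr1 /W /pos.
    by case: leP => _; ring.
  move=> d3.
  have : is_derive z 1 (fun u => 4 / 3 * (W u * (u - c))) (4 / 3 * (3 * W z)).
    exact: (@is_deriveZ _ _ _ _ (4 / 3) _ _ _ d3).
  move=> d4; apply: is_derive_eq.
  by rewrite /w' /W; field.
have wmono : {homo w : x y / x <= y}.
  move=> u v uv; rewrite /w ler_pM2l ?divr_gt0// /pos.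
  case: (leP (u - c) 0) => u0; case: (leP (v - c) 0) => v0; try lra.
    by rewrite expr0n mul0r mulr_ge0 ?sqr_ge0 ?ltW.
  rewrite -!exprSr ler_pXn2r ?nnegrE ?lerD2r//; exact: ltW.
have cpos : continuous (fun z : R => pos (z - c)).
  move=> z; apply: (@continuous_comp _ _ _ (fun u => u - c) pos).
    by apply: cvgB; [exact: cvg_id|exact: cvg_cst].
  exact: continuous_pos.
have cW' : continuous (fun z : R => 2 * pos (z - c)).
  by move=> z; apply: cvgM; [exact: cvg_cst|exact: cpos].
have cw' : continuous w'.
  by move=> z; rewrite /w'; under eq_fun do rewrite expr2; apply: cvgM; exact: cW'.
have := monotone_test_le wmono dw cw'.
have f1 : f' 1 = (b1 - f 1) / gamma by rewrite -bc1; field; exact: lt0r_neq0.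
have f2 : f' (-1) = (f (-1) - b2) / gamma by rewrite -bc2; field; exact: lt0r_neq0.
have sgn b z : b <= c -> (b - z) / gamma * w z <= 0.
  move=> bc; rewrite mulrAC pmulr_lle0 ?invr_gt0//.
  rewrite /w /pos; case: (leP (z - c) 0) => [zc|zc].
    by rewrite expr0n mul0r !mulr0.
  apply: mulr_le0_ge0; first by lra.
  by rewrite !mulr_ge0 ?sqr_ge0 ?ltW// divr_ge0.
have T1 := sgn _ (f 1) b1c.
have T2 := sgn _ (f (-1)) b2c.
rewrite f1 f2 => I1.
have I0 : 0 <= \int[mu]_(x in @Omega R) (f' x ^+ 2 * w' (f x)).
  by apply: Rintegral_ge0 => y _; rewrite mulr_ge0 ?sqr_ge0.
have {}T2 : (b2 - f (-1)) / gamma * w (f (-1)) = 0.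
  apply/eqP; rewrite eq_le T2 /=; apply: le_trans I0 _; apply: le_trans I1 _.
  rewrite -[leRHS]add0r; apply: lerD => //.
  by rewrite -mulNr -mulNr opprB.
have W1 : W (f (-1)) = 0.
  rewrite /W /pos; case: leP => [_|fc]; first by rewrite expr0n.
  exfalso; move: T2; apply/eqP; rewrite lt_eqF// pmulr_llt0.
    by rewrite pmulr_llt0 ?invr_gt0//; lra.
  by rewrite /w /pos max_l ?ltW// !mulr_gt0 ?exprn_gt0 ?invr_gt0.
have [cf _] := df; have [cf' _] := df'.
have := poincare (antider_comp dW df) (contM cf' (cont_comp cW' cf)) W1 Ox.
under eq_Rintegral do rewrite exprMn.
rewrite -/w' => HW.
have W0 : W (f x) ^+ 2 <= 0.
  apply: le_trans HW _; rewrite pmulr_rle0//; apply: le_trans I1 _.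
  rewrite -[leRHS]addr0; apply: lerD => //.
  by rewrite -mulNr -mulNr opprB T2.
move: W0; rewrite /W /pos; case: (leP (f x - c) 0) => [|fc]; first by rewrite subr_le0.
by rewrite -exprM leNgt exprn_gt0.
Qed.

End SteadyState.

(** * The dissipation inequality *)

Section Dissipation.
Context {R : realType}.
Variables (eps gamma c0 : R) (psi' d0 e0 D delta delta' H eta eta' : R -> R).
Hypotheses (eps0 : 0 < eps) (gamma0 : 0 < gamma).
Hypotheses (cd0 : continuous_on_Omega d0) (ce0 : continuous_on_Omega e0).
Hypothesis dpsi' : antider psi' (fun x => eps^-1 * d0 x).
Hypotheses (c00 : 0 <= c0) (e0_ge : forall x, Omega x -> c0 <= e0 x).
Hypothesis e0_le : forall x, Omega x -> e0 x - c0 <= eps / 2 * psi' x ^+ 2.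
Hypothesis small_grad :
  eps * (5 / 8 * \int[mu]_(x in @Omega R) (psi' x ^+ 2)) <= 2 * c0 * gamma.
Hypotheses (dD : antider D delta) (ddelta : antider delta delta').
Hypotheses (dH : antider H eta) (deta : antider eta eta').
Hypotheses (cdelta' : continuous_on_Omega delta') (ceta' : continuous_on_Omega eta').
Hypotheses (D1 : D 1 = 0) (DN1 : D (-1) = 0) (H1 : H 1 = 0) (HN1 : H (-1) = 0).

Let s := (1 + gamma)^-1.
Let d := 2^-1 * \int[mu]_(x in @Omega R) D x.
Let phi' x := eps^-1 * (D x - s * d).

(** See the introduction: Q' below is the exact derivative to be subtracted and R'
a pointwise upper bound of the remainder, in which D^2 has been replaced by its
tangent 2 d D - d^2 so that only the mean of D enters. *)
Lemma dissipation :
  \int[mu]_(x in @Omega R)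
    (D x * (delta' x - e0 x * phi' x - eta x * psi' x)
     + H x * (eta' x - d0 x * phi' x - delta x * psi' x))
  <= - 2^-1 * \int[mu]_(x in @Omega R) (delta x ^+ 2 + eta x ^+ 2).
Proof.
have [cpsi' _] := dpsi'; have [cD _] := dD; have [cH _] := dH.
have [cdelta _] := ddelta; have [ceta _] := deta.
have s0 : 0 < s by rewrite /s invr_gt0 addr_gt0.
have s1 : s <= 1 by rewrite /s invf_le1 ?lerDl ?ltW ?addr_gt0.
have i0 : 0 < eps^-1 by rewrite invr_gt0.
pose Q' x := delta x * delta x + D x * delta' x + (eta x * eta x + H x * eta' x)
  - ((delta x * H x + D x * eta x) * psi' x + D x * H x * (eps^-1 * d0 x))
  + s * d * (eps^-1 * d0 x * H x + psi' x * eta x).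
have dQ := antiderD
  (antiderB (antiderD (antiderM dD ddelta) (antiderM dH deta))
            (antiderM (antiderM dD dH) dpsi'))
  (antiderZ (s * d) (antiderM dpsi' dH)).
have cc (c : R) := @cont_cst R c.
have cQ' : continuous_on_Omega Q'.
  exact: (contD
    (contB (contD (contD (contM cdelta cdelta) (contM cD cdelta'))
                (contD (contM ceta ceta) (contM cH ceta')))
          (contD (contM (contD (contM cdelta cH) (contM cD ceta)) cpsi')
                (contM (contM cD cH) (contM (cc _) cd0))))
    (contM (cc _) (contD (contM (contM (cc _) cd0) cH) (contM cpsi' ceta)))).
have Q'0 : \int[mu]_(x in @Omega R) Q' x = 0.
  by rewrite (FTC_Omega dQ cQ') D1 DN1 H1 HN1; ring.
have csum : continuous_on_Omega (fun x => delta x ^+ 2 + eta x ^+ 2).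
  by apply: contD; exact: contX.
pose k := c0 * eps^-1 * d.
pose R' x := - 2^-1 * (delta x ^+ 2 + eta x ^+ 2)
   + (5 / 8 * (s * d) ^+ 2 * psi' x ^+ 2 + (- k * (2 - s) * D x + k * d)).
have cpsi2 : continuous_on_Omega (fun x => psi' x ^+ 2) by exact: contX.
have cR1 : continuous_on_Omega (fun x => - k * (2 - s) * D x + k * d).
  by apply: contD => //; apply: contM.
have cR2 : continuous_on_Omega (fun x => 5 / 8 * (s * d) ^+ 2 * psi' x ^+ 2).
  by apply: contM.
have cR3 : continuous_on_Omega (fun x => - 2^-1 * (delta x ^+ 2 + eta x ^+ 2)).
  by apply: contM.
have cR' : continuous_on_Omega R'.
  by apply: contD => //; apply: contD.
apply: (@le_trans _ _ (\int[mu]_(x in @Omega R) (Q' x + R' x))).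
  apply: cont_le_integral; last 1 first.
  - move=> x Ox; rewrite /Q' /R' /phi' /k.
    have eip : eps^-1 * (e0 x - c0) <= psi' x ^+ 2 / 2.
      rewrite -(ler_pM2l eps0) mulrA mulfV ?lt0r_neq0// mul1r.
      by rewrite (_ : _ * (_ / 2) = eps / 2 * psi' x ^+ 2) ?e0_le//; field.
    have ec := e0_ge Ox.
    move: (eps^-1) i0 (psi' x) (D x) (H x) (delta x) (delta' x) (eta x) (eta' x)
     (e0 x) (d0 x) ec eip => i i0 p X Y u u' v v' e dd ec eip.
    rewrite -subr_ge0.
    set T := (X in 0 <= X).
    (* Completing squares; the first integral enters through the last bracket. *)
    have -> : T = 2^-1 * u ^+ 2 + 2^-1 * (v + s * d * p) ^+ 2
       + c0 * i * (X - d) ^+ 2 + (e - c0) * i * (X - s * d / 2) ^+ 2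
       + (s * d / 2) ^+ 2 * (p ^+ 2 / 2 - i * (e - c0)) by rewrite /T; field.
    have i0' := ltW i0.
    have h0 : (0 : R) <= 2^-1 by rewrite invr_ge0.
    have ec' : 0 <= e - c0 by rewrite subr_ge0.
    have eip' : 0 <= p ^+ 2 / 2 - i * (e - c0) by rewrite subr_ge0.
    apply: addr_ge0 (mulr_ge0 (sqr_ge0 _) eip').
    apply: addr_ge0 (mulr_ge0 (mulr_ge0 ec' i0') (sqr_ge0 _)).
    apply: addr_ge0 (mulr_ge0 (mulr_ge0 c00 i0') (sqr_ge0 _)).
    exact: addr_ge0 (mulr_ge0 h0 (sqr_ge0 _)) (mulr_ge0 h0 (sqr_ge0 _)).
  - have cphi' : continuous_on_Omega phi' by exact: (contM (cc _) (contB cD (cc _))).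
    exact: (contD
      (contM cD (contB (contB cdelta' (contM ce0 cphi')) (contM ceta cpsi')))
      (contM cH (contB (contB ceta' (contM cd0 cphi')) (contM cdelta cpsi')))).
  - exact: contD.
rewrite cont_integralD// Q'0 add0r.
set P := \int[mu]_(x in @Omega R) (psi' x ^+ 2).
have -> : \int[mu]_(x in @Omega R) R' x =
    - 2^-1 * \int[mu]_(x in @Omega R) (delta x ^+ 2 + eta x ^+ 2)
    + (5 / 8 * (s * d) ^+ 2 * P + (- k * (2 - s) * (2 * d) + k * d * 2)).
  rewrite /R' cont_integralD//; last exact: contD.
  congr (_ + _); first exact: cont_integralZ.
  rewrite cont_integralD//; congr (_ + _); first exact: cont_integralZ.
  rewrite cont_integralD//; last exact: contM.
  rewrite integral_cst_Omega; congr (_ + _).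
  by rewrite cont_integralZ// /d; field.
rewrite gerDl.
have P0 : 0 <= P by apply: Rintegral_ge0 => x _; exact: sqr_ge0.
have -> : 5 / 8 * (s * d) ^+ 2 * P + (- k * (2 - s) * (2 * d) + k * d * 2) =
   s * d ^+ 2 * eps^-1 * (s * (eps * (5 / 8 * P)) - 2 * c0 * gamma).
  (* The mean enters through 2 d^2 (1 - s) = 2 gamma s d^2. *)
  have -> : gamma = s^-1 - 1 by rewrite /s invrK addrC addKr.
  by rewrite /k; field; rewrite !lt0r_neq0.
apply: mulr_ge0_le0; first exact: mulr_ge0 (mulr_ge0 (ltW s0) (sqr_ge0 d)) (ltW i0).
rewrite subr_le0; apply: le_trans small_grad; rewrite ler_piMl//.
by rewrite mulr_ge0 ?(ltW eps0)// mulr_ge0// divr_ge0.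
Qed.

End Dissipation.

(** * The steady state *)

Section SteadyEstimates.
Context {R : realType}.
Variables (eps gamma m0 phi1 : R) (psi : R -> R).
Hypotheses (eps0 : 0 < eps) (gamma0 : 0 < gamma) (m00 : 0 < m0) (phi10 : 0 < phi1).
Hypothesis ss : steady_state eps gamma m0 phi1 psi.

Let In := \int[mu]_(y in @Omega R) expR (psi y).
Let Ip := \int[mu]_(y in @Omega R) expR (- psi y).
Let A := m0 / In.
Let B := m0 / Ip.

Lemma n0E x : n0 m0 psi x = A * expR (psi x).
Proof. by rewrite /n0 -/In mulrAC. Qed.

Lemma p0E x : p0 m0 psi x = B * expR (- psi x).
Proof. by rewrite /p0 -/Ip mulrAC. Qed.

Lemma antider_psi : antider psi (ddx psi).
Proof. by have [[+ _] _ _ _] := ss; exact: antider_ddx. Qed.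

Let cpsi : continuous_on_Omega psi.
Proof. exact: antider_cont antider_psi. Qed.

Let ce : continuous_on_Omega (fun x => expR (psi x)).
Proof. exact: cont_expR. Qed.

Let cem : continuous_on_Omega (fun x => expR (- psi x)).
Proof. by apply: cont_expR; exact: contN. Qed.

Let In0 : 0 < In.
Proof. by apply: cont_integral_gt0 => // x _; exact: expR_gt0. Qed.

Let Ip0 : 0 < Ip.
Proof. by apply: cont_integral_gt0 => // x _; exact: expR_gt0. Qed.

Let A0 : 0 < A. Proof. exact: divr_gt0. Qed.
Let B0 : 0 < B. Proof. exact: divr_gt0. Qed.

Lemma antider_n0 : antider (n0 m0 psi) (fun x => n0 m0 psi x * ddx psi x).
Proof.
rewrite (_ : n0 m0 psi = fun x => A * expR (psi x)); last first.
  by apply/funext => x; rewrite n0E.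
have := antiderZ A (antider_comp (@is_derive_expR R) antider_psi).
by apply: antiderE => x _; ring.
Qed.

Lemma antider_p0 : antider (p0 m0 psi) (fun x => - (p0 m0 psi x * ddx psi x)).
Proof.
rewrite (_ : p0 m0 psi = fun x => B * expR (- psi x)); last first.
  by apply/funext => x; rewrite p0E.
have := antiderZ B (antider_comp (@is_derive_expR R) (antiderN antider_psi)).
by apply: antiderE => x _; ring.
Qed.

Lemma antider_eta0 : antider (eta0 m0 psi) (fun x => delta0 m0 psi x * ddx psi x).
Proof.
have := antiderD antider_n0 antider_p0.
by apply: antiderE => x _; rewrite /delta0; ring.
Qed.

Lemma antider_delta0 : antider (delta0 m0 psi) (fun x => eta0 m0 psi x * ddx psi x).
Proof.
have := antiderB antider_n0 antider_p0.
by apply: antiderE => x _; rewrite /eta0; ring.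
Qed.

Lemma antider_dpsi :
  antider (ddx psi) (fun x => eps^-1 * delta0 m0 psi x).
Proof.
have [[_ c1] eq _ _] := ss.
have := antider_ddx c1; apply: antiderE => x xI.
by rewrite /delta0 -eq// mulKf// lt0r_neq0.
Qed.

Let charge x := A * expR (psi x) - B * expR (- psi x).

Let delta0E : delta0 m0 psi = charge.
Proof. by apply/funext => x; rewrite /delta0 n0E p0E. Qed.

Let dpsi' : antider (ddx psi) (fun x => eps^-1 * charge x).
Proof. by rewrite -delta0E; exact: antider_dpsi. Qed.

Lemma neutrality : ddx psi 1 = ddx psi (-1).
Proof.
apply/eqP; rewrite -subr_eq0 -(FTC_Omega dpsi'); last first.
  by rewrite -delta0E; apply: contM; [exact: cont_cst|exact: (antider_cont antider_delta0)].
have c1 : continuous_on_Omega (fun x => A * expR (psi x)).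
  by apply: contM => //; exact: cont_cst.
have c2 : continuous_on_Omega (fun x => B * expR (- psi x)).
  by apply: contM => //; exact: cont_cst.
rewrite cont_integralZ; last exact: contB.
rewrite RintegralB; [|exact: measurable_Omega|exact: cont_integrable..].
rewrite !cont_integralZ// /A /B !divfK ?lt0r_neq0//.
by rewrite subrr mulr0.
Qed.

Lemma grad_psi_le :
  \int[mu]_(x in @Omega R) (ddx psi x ^+ 2) <= phi1 ^+ 2 / (2 * gamma).
Proof.
have [_ _ bcr bcl] := ss.
exact: (grad_sqr_le A0 B0 eps0 antider_psi dpsi' neutrality gamma0 bcr bcl).
Qed.

Lemma psi_le x : Omega x -> psi x <= phi1.
Proof.
have [_ _ bcr bcl] := ss.
apply: (maximum_principle A0 B0 eps0 antider_psi dpsi' neutrality gamma0 bcr bcl) => //.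
by have := phi10; lra.
Qed.

(** The maximum principle for - psi, which solves the equation with A and B
exchanged. *)
Lemma psi_ge x : Omega x -> - phi1 <= psi x.
Proof.
have [_ _ bcr bcl] := ss => Ox; rewrite lerNl.
have bcr' : - psi 1 + gamma * - ddx psi 1 = - phi1 by rewrite -bcr; ring.
have bcl' : - psi (-1) - gamma * - ddx psi (-1) = phi1.
  by rewrite -[phi1]opprK -bcl; ring.
have dm := antiderN dpsi'.
have dm' : antider (fun x => - ddx psi x)
    (fun x => eps^-1 * (B * expR (- psi x) - A * expR (- - psi x))).
  by apply: antiderE dm => y _; rewrite opprK /charge; ring.
have neu : - ddx psi 1 = - ddx psi (-1) by rewrite neutrality.
apply: (maximum_principle B0 A0 eps0 (antiderN antider_psi) dm' neu gamma0 bcr' bcl') => //.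
by have := phi10; lra.
Qed.

(** The bounds on psi give m0 / int e^psi >= m0 e^(- phi1) / 2, likewise for
e^(- psi), and e^psi + e^(- psi) >= 2. *)
Lemma eta0_ge x : Omega x -> m0 * expR (- phi1) <= eta0 m0 psi x.
Proof.
move=> Ox.
have I2 (f : R -> R) : continuous_on_Omega (fun x => expR (f x)) ->
   (forall x, Omega x -> f x <= phi1) ->
   \int[mu]_(y in @Omega R) expR (f y) <= expR phi1 * 2.
  move=> cf fle; rewrite -integral_cst_Omega; apply: cont_le_integral => //.
    exact: cont_cst.
  by move=> y Oy; rewrite ler_expR fle.
have half : expR (- phi1) / 2 = (expR phi1 * 2)^-1 by rewrite expRN invfM.
have An : m0 * (expR (- phi1) / 2) <= A.
  rewrite ler_pM2l// half lef_pV2 ?posrE//; last by rewrite mulr_gt0 ?expR_gt0.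
  by apply: I2 => //; exact: psi_le.
have Bn : m0 * (expR (- phi1) / 2) <= B.
  rewrite ler_pM2l// half lef_pV2 ?posrE//; last by rewrite mulr_gt0 ?expR_gt0.
  by apply: I2 => // y Oy; rewrite lerNl psi_ge.
have kmin_ge0 : 0 <= m0 * (expR (- phi1) / 2).
  apply: ltW; apply: mulr_gt0 => //; apply: divr_gt0 => //; exact: expR_gt0.
rewrite /eta0 n0E p0E.
have -> : m0 * expR (- phi1) = m0 * (expR (- phi1) / 2) * 2 by field.
set K := m0 * (expR (- phi1) / 2) in An Bn kmin_ge0 *.
apply: (@le_trans _ _ (K * (expR (psi x) + expR (- psi x)))); last first.
  by rewrite mulrDr; apply: lerD; apply: ler_wpM2r => //; exact: expR_ge0.
apply: ler_wpM2l => //.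
by have := expR_ge1Dx (psi x); have := expR_ge1Dx (- psi x); lra.
Qed.

(** eps/2 psi_x^2 - eta0 has derivative psi_x (eps psi_xx - delta0) = 0. *)
Lemma first_integral x y : Omega x -> Omega y ->
  eta0 m0 psi x - eta0 m0 psi y = eps / 2 * (ddx psi x ^+ 2 - ddx psi y ^+ 2).
Proof.
move=> Ox Oy.
have d0 : antider (fun x => eta0 m0 psi x - eps / 2 * (ddx psi x * ddx psi x)) (fun=> 0).
  have := antiderB antider_eta0 (antiderZ (eps / 2) (antiderM antider_dpsi antider_dpsi)).
  by apply: antiderE => z _; field; exact: lt0r_neq0.
have := antider0_cst d0 Ox Oy; rewrite -!expr2 => E.
by apply/eqP; rewrite -subr_eq0; apply/eqP; lra.
Qed.

Lemma eta0_range : exists c0, [/\ m0 * expR (- phi1) <= c0,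
  forall x, Omega x -> c0 <= eta0 m0 psi x &
  forall x, Omega x -> eta0 m0 psi x - c0 <= eps / 2 * ddx psi x ^+ 2].
Proof.
have le11 : (-1 : R) <= 1 by rewrite -subr_ge0; lra.
have [c Oc cmin] := EVT_min le11 (antider_cont antider_eta0).
exists (eta0 m0 psi c); split.
- exact: eta0_ge.
- by move=> x Ox; exact: cmin.
- move=> x Ox; rewrite first_integral// ler_pM2l ?divr_gt0//.
  by rewrite gerBl sqr_ge0.
Qed.

End SteadyEstimates.

(** * The constants M and K0 *)

Section Constants.
Context {R : realType}.

Lemma K0_ge1 (phi1 : R) : 0 < phi1 -> 1 <= K0 phi1.
Proof.
move=> p0; apply: (@le_trans _ _ (`|expR phi1 - 1| / `|phi1|)).
  rewrite ler_pdivlMr ?normr_gt0 ?gt_eqF// mul1r !gtr0_norm ?subr_gt0 ?expR_gt1//.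
  by have := expR_ge1Dx phi1; lra.
apply: ub_le_sup; last first.
  by exists phi1 => //=; rewrite gtr0_norm// p0 lexx.
exists (expR phi1) => _ [y /= /andP[y0 yp] <-].
rewrite ler_pdivrMr//.
have := yp; rewrite ler_norml => /andP[yl yr].
have e1 := expR_ge1Dx y; have e2 := expR_ge1Dx (- y).
have ey : expR y <= expR phi1 by rewrite ler_expR.
have ep := expR_gt0 y.
have e3 : expR y * expR (- y) = 1 by rewrite -expRD subrr expR0.
have e4 : expR y - 1 <= expR y * y.
  have := ler_wpM2l (ltW ep) e2; rewrite e3; lra.
have e5 : 1 <= expR phi1 by rewrite -expR0 ler_expR ltW.
move: e5 ey ep e1 e4; move: (expR y) (expR phi1) => E P e5 ey ep e1 e4.
rewrite ler_norml; apply/andP; split.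
  have : y >= - `|y| by rewrite lerNl ler_normr lexx orbT.
  have := normr_ge0 y; nra.
have : y <= `|y| by exact: ler_norm.
by have := normr_ge0 y; nra.
Qed.

(** As K0 >= 1 and (1 + 2 gamma_max)^2 + 3 >= 4, the hypothesis implies
gamma / sqrt eps >= phi1 / M; square it. *)
Lemma gamma_sqr_ge (m0 phi1 eps gamma gamma_max : R) :
  0 < m0 -> 0 < phi1 -> 0 < eps -> 0 < gamma -> 0 < gamma_max ->
  ((1 + 2 * gamma_max) ^+ 2 + 3) * K0 phi1 * phi1 / (4 * M m0 phi1)
    < gamma / Num.sqrt eps ->
  eps * phi1 ^+ 2 <= gamma ^+ 2 * (m0 * expR (- phi1)).
Proof.
move=> m p e g gm.
have M0 : 0 < M m0 phi1 by rewrite /M sqrtr_gt0 divr_gt0// mulr_gt0 ?expR_gt0.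
have M2 : M m0 phi1 ^+ 2 = m0 * expR (- phi1) / 2.
  rewrite /M sqr_sqrtr; last by rewrite divr_ge0 ?mulr_ge0 ?expR_ge0 ?ltW.
  by rewrite expRN; field; rewrite gt_eqF ?expR_gt0.
have se : 0 < Num.sqrt eps by rewrite sqrtr_gt0.
have k1 := K0_ge1 p.
rewrite ltr_pdivrMr ?mulr_gt0// [ltRHS]mulrAC ltr_pdivlMr// => H.
have H1 : phi1 * Num.sqrt eps <= gamma * M m0 phi1.
  have k2 : 4 <= ((1 + 2 * gamma_max) ^+ 2 + 3) * K0 phi1.
    by have : 1 <= (1 + 2 * gamma_max) ^+ 2; nra.
  have ps : 0 <= phi1 * Num.sqrt eps by rewrite mulr_ge0 ?ltW.
  have := ler_wpM2r ps k2; lra.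
have : (phi1 * Num.sqrt eps) ^+ 2 <= (gamma * M m0 phi1) ^+ 2.
  by rewrite ler_sqr ?nnegrE// ltW// mulr_gt0.
rewrite !exprMn M2 (sqr_sqrtr (ltW e)) => H2.
have : 0 <= gamma ^+ 2 * (m0 * expR (- phi1)).
  by rewrite mulr_ge0 ?sqr_ge0// mulr_ge0 ?expR_ge0// ltW.
by lra.
Qed.

End Constants.

(** * Differentiation in time and the integrated equations *)

Section SpaceTime.
Context {R : realType}.
Implicit Types (u : R -> R -> R) (x t a b : R).

Lemma ST_slice u t : continuous_ST u -> 0 < t -> continuous_on_Omega (u ^~ t).
Proof.
move=> /subspace_continuousP cu t0; apply/subspace_continuousP => x Ox.
have := cu (x, t); rewrite /= in_itv /= andbT => /(_ (conj Ox t0)) cxt V HV.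
have [[U W] [/= Ux Wt] UW] := cxt V HV.
by apply: filterS Ux => y Uy Oy; apply: (UW (y, t)) => /=;
  split => //=; [exact: nbhs_singleton Wt|rewrite in_itv /= andbT].
Qed.

(** Supplies the constant dominating functions for differentiation under the
integral sign. *)
Lemma ST_bounded u a b : continuous_ST u -> 0 < a -> a <= b ->
  exists2 C, 0 <= C & forall x t, Omega x -> a <= t <= b -> `|u x t| <= C.
Proof.
move=> cu a0 ab.
pose K : set (R * R) := @Omega R `*` `[a, b].
have cK : compact K by apply: compact_setX; exact: segment_compact.
have Knonempty : K !=set0.
  exists (0, a); split => /=; last by rewrite in_itv /= lexx ab.
  by apply: Omega_oo; rewrite ltrN10 ltr01.
have KS : K `<=` @Omega R `*` `]0, +oo[.
  move=> [x t] [/= Ox]; rewrite !in_itv /= => /andP[ta _].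
  by split => //=; rewrite ?in_itv /= ?andbT (lt_le_trans a0).
have cu' : {within K, continuous (fun z : R * R => `|u z.1 z.2|)}.
  move=> z; apply: cvg_norm; exact: (continuous_subspaceW KS cu).
have [c Kc cmax] := compact_EVT_max Knonempty cK cu'.
exists `|u c.1 c.2| => // x t Ox tab.
by apply: (cmax (x, t)); rewrite inE; split => //=; rewrite in_itv.
Qed.

(** Differentiation under the integral sign with a constant dominating function,
which is integrable because B is bounded. *)
Lemma is_derive_integral (B : set R) (f f' : R -> R -> R) a b C t :
  measurable (B : set (measurableTypeR R)) -> B `<=` @Omega R ->
  (forall r, a < r < b -> mu.-integrable B (EFin \o (f ^~ r))) ->
  (forall x r, B x -> a < r < b -> is_derive r 1 (f x) (f' x r)) ->
  (forall x r, B x -> a < r < b -> `|f' x r| <= C) -> 0 <= C -> a < t < b ->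
  is_derive t 1 (fun r => \int[mu]_(x in B) f x r) (\int[mu]_(x in B) f' x t).
Proof.
move=> mB BO fi df f'C C0 tab.
have I r : `]a, b[%classic r -> a < r < b by rewrite /= in_itv.
have It : `]a, b[%classic t by rewrite /= in_itv.
have d1 : forall r x, `]a, b[%classic r -> B x -> derivable (f x) r 1.
  by move=> r x /I ri Bx; have [] := df x r Bx ri.
have iC : mu.-integrable B (EFin \o (fun=> C)).
  exact: (integrableS (@measurable_Omega R) mB BO (cont_integrable (@cont_cst R C))).
have d1E r x : `]a, b[%classic r -> B x -> partial1of2 (fun r x => f x r) r x = f' x r.
  by move=> /I ri Bx; rewrite partial1of2E; have [] := df x r Bx ri.
have bound r x : `]a, b[%classic r -> B x ->
    `|partial1of2 (fun r x => f x r) r x| <= C.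
  by move=> Ir Bx; rewrite d1E//; apply: f'C => //; exact: I.
have fi' r : `]a, b[%classic r -> mu.-integrable B (EFin \o f ^~ r).
  by move=> /I; exact: fi.
have D1 := derivable_under_integral mB It fi' d1 (fun=> C0) iC bound.
have D2 := differentiation_under_integral mB It fi' d1 (fun=> C0) iC bound.
apply: DeriveDef; first exact: D1.
rewrite -derive1E D2; apply: eq_Rintegral => x /set_mem Bx; exact: d1E.
Qed.

Lemma abs_primitive_le (g : R -> R) (C x : R) : continuous_on_Omega g ->
  (forall y, Omega y -> `|g y| <= C) -> 0 <= C -> Omega x ->
  `|\int[mu]_(y in `[-1, x]) g y| <= 2 * C.
Proof.
move=> cg gC C0 Ox; rewrite -ler_sqr ?nnegrE ?mulr_ge0// real_normK ?num_real//.
apply: (@le_trans _ _ (2 * (C ^+ 2 * 2))); last by nra.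
have H := sqr_integral_le Ox (cont_integrable cg) (cont_integrable (@contX _ _ 2 cg)).
apply: (le_trans H).
rewrite ler_pM2l// -integral_cst_Omega; apply: cont_le_integral.
- exact: contX.
- exact: cont_cst.
- by move=> y Oy; rewrite -real_normK ?num_real// ler_sqr ?nnegrE ?gC.
Qed.

Lemma is_derive_primitive u t x : regular_xt u -> 0 < t -> Omega x ->
  is_derive t 1 (primitive u x) (\int[mu]_(y in `[-1, x]) dT u y t).
Proof.
move=> [[cu _ _ _ _] du cut] t0 Ox.
have t2 : 0 < t / 2 by rewrite divr_gt0.
have ab : t / 2 <= t * 2 by lra.
have [C C0 uC] := ST_bounded cut t2 ab.
have sub : `[-1, x] `<=` @Omega R.
  move: Ox; rewrite OmegaE => /andP[_ x1] y.
  by rewrite /Omega /= !in_itv /= => /andP[-> /le_trans->].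
apply: (@is_derive_integral _ u (dT u) (t / 2) (t * 2) C) => //.
- move=> r /andP[r1 _]; apply: integrable_itv => //; apply: cont_integrable.
  by apply: ST_slice => //; exact: lt_trans r1.
- move=> y r yx /andP[r1 _]; apply: DeriveDef.
    by apply: du; [exact: sub|exact: lt_trans r1].
  by rewrite /dT derive1E.
- by move=> y r yx /andP[r1 r2]; apply: uC; [exact: sub|rewrite !ltW].
- by apply/andP; split; lra.
Qed.

Lemma antider_x u t : regular_x u -> 0 < t -> antider (u ^~ t) (dX u ^~ t).
Proof.
move=> [cu du _ _ _] t0; split; first exact: ST_slice.
by move=> x xI; apply: ddx_interior => //; apply: du => //; exact: Omega_oo.
Qed.

Lemma antider_xx u t : regular_x u -> 0 < t -> antider (dX u ^~ t) (dX (dX u) ^~ t).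
Proof.
move=> [_ _ cu du _] t0; split; first exact: ST_slice.
by move=> x xI; apply: ddx_interior => //; apply: du => //; exact: Omega_oo.
Qed.

(** The equations for delta and eta have the same shape, with (c, v) = (eta0, eta)
and (delta0, delta): the right-hand side is the x-derivative of the flux, and the
flux vanishes at -1. *)
Lemma flux_identity (c c' psi' psi'' : R -> R) u v phi t x :
  antider c c' -> antider psi' psi'' ->
  regular_xt u -> regular_x v -> regular_x phi -> 0 < t ->
  (forall y, -1 < y < 1 -> dT u y t = dX (dX u) y t
      - ddx (fun z => c z * dX phi z t) y - ddx (fun z => v z t * psi' z) y) ->
  dX u (-1) t - c (-1) * dX phi (-1) t - v (-1) t * psi' (-1) = 0 ->
  Omega x ->
  \int[mu]_(y in `[-1, x]) dT u y t =
  dX u x t - c x * dX phi x t - v x t * psi' x.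
Proof.
move=> dc dpsi ru rv rphi t0 eq bc Ox.
have dq1 := antiderM dc (antider_xx rphi t0).
have dq2 := antiderM (antider_x rv t0) dpsi.
have dF := antiderB (antiderB (antider_xx (regular_xt_x ru) t0) dq1) dq2.
have dF' : antider (fun y => dX u y t - c y * dX phi y t - v y t * psi' y)
    (dT u ^~ t).
  apply: antiderE dF => y yI; rewrite eq//.
  by rewrite (is_derive_ddx yI (dq1.2 y yI)) (is_derive_ddx yI (dq2.2 y yI)).
by rewrite (FTC dF' (ST_slice (regular_cont_t ru) t0) Ox) bc subr0.
Qed.

End SpaceTime.

(** * Behaviour at the initial time *)

Section InitialLayer.
Context {R : realType}.
Implicit Types (u : R -> R -> R) (x t : R).

Lemma nonincreasing_of_derive (y y' : R -> R) (s t : R) :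
  (forall r : R, 0 < r -> is_derive r 1 y (y' r)) ->
  (forall r : R, 0 < r -> y' r <= 0) -> 0 < s -> s <= t -> y t <= y s.
Proof.
move=> dy y0 s0 st.
have pos (r : R) : r \in `[s, t] -> 0 < r.
  by rewrite in_itv /= => /andP[sr _]; exact: lt_le_trans sr.
have poso (r : R) : r \in `]s, t[ -> 0 < r.
  by rewrite in_itv /= => /andP[sr _]; exact: lt_trans sr.
apply: (@ler0_derive1_le_cc _ y s t) => //.
- by move=> r /poso r0; have [] := dy r r0.
- by move=> r /poso r0; rewrite derive1E; have [_ ->] := dy r r0; exact: y0.
- apply: derivable_within_continuous => r /pos r0; by have [] := dy r r0.
- by rewrite in_itv /= st lexx.
- by rewrite in_itv /= lexx st.
Qed.

Lemma right_limit_ge (g : R -> R) (l c t : R) : 0 < t ->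
  g r @[r --> 0^'+] --> l -> (forall r, 0 < r -> r <= t -> c <= g r) -> c <= l.
Proof.
move=> t0 gl cg; apply: (cvgr_to_ge gl); near=> r; apply: cg; near: r.
- exact: nbhs_right_gt.
- exact: nbhs_right_le.
Unshelve. all: by end_near. Qed.

Lemma initial_integrable u : L2_initial u ->
  mu.-integrable (@Omega R) (EFin \o (u ^~ 0)).
Proof. by move=> [mu0 iu0 _]; exact: L2_integrable. Qed.

Definition L2_gap u t := \int[mu]_(x in @Omega R) ((u x t - u x 0) ^+ 2).

Lemma L2_gap_cvg u : L2_initial u -> L2_gap u t @[t --> 0^'+] --> 0.
Proof. by move=> [_ _ /fine_cvg]. Qed.

(** The continuity at t = 0 that the primitives inherit from the L^2 continuity of
the densities. *)
Lemma primitive_gap u t x : L2_initial u -> continuous_ST u -> 0 < t -> Omega x ->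
  (primitive u x t - primitive u x 0) ^+ 2 <= 2 * L2_gap u t.
Proof.
move=> iu cu t0 Ox.
have i0 := initial_integrable iu.
have ct := ST_slice cu t0.
have it := cont_integrable ct.
rewrite /primitive -RintegralB//; [|exact: integrable_itv..].
apply: sqr_integral_le => //; first by apply: integrableR_sub => //; exact: measurable_Omega.
have i2 : mu.-integrable (@Omega R)
    (EFin \o (fun y => 2 * (u y t ^+ 2) + 2 * (u y 0 ^+ 2))).
  have [_ iu0 _] := iu.
  apply: integrableR_add; [exact: measurable_Omega| |].
    by apply: integrableR_scale; [exact: measurable_Omega|apply: cont_integrable; exact: contX].
  by apply: integrableR_scale; first exact: measurable_Omega.
apply: le_integrable i2; first exact: measurable_Omega.
  have [m0 _ _] := iu.
  apply/measurable_EFinP; apply: measurable_funX; apply: measurable_funB => //.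
  by case/integrableP : it => /measurable_EFinP.
move=> y _; rewrite /= lee_fin ger0_norm ?sqr_ge0// ger0_norm; last first.
  by rewrite addr_ge0// mulr_ge0 ?sqr_ge0.
by have := sqr_ge0 (u y t + u y 0); lra.
Qed.

Lemma cont_primitive_at u t : L2_initial u -> continuous_ST u -> 0 <= t ->
  continuous_on_Omega (primitive u ^~ t).
Proof.
move=> iu cu; rewrite le_eqVlt => /predU1P[<-|t0]; apply: cont_primitive.
  exact: initial_integrable.
exact: cont_integrable (ST_slice cu t0).
Qed.

(** The variance formula: int (u - m)^2 = int u^2 - 2 m^2 on an interval of
length 2. *)
Lemma energyE (d e : R -> R -> R) t : continuous_on_Omega (primitive d ^~ t) ->
  continuous_on_Omega (primitive e ^~ t) ->
  energy d e t =
  2^-1 * \int[mu]_(x in @Omega R) (primitive d x t ^+ 2 + primitive e x t ^+ 2).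
Proof.
move=> cd ce; rewrite /energy.
have cc (c : R) := @cont_cst R c.
have sq (u : R -> R -> R) : continuous_on_Omega (primitive u ^~ t) ->
   \int[mu]_(x in @Omega R) (centered_primitive u x t ^+ 2) =
   \int[mu]_(x in @Omega R) (primitive u x t ^+ 2) - 2 * mean_primitive u t ^+ 2.
  move=> cu; set m := mean_primitive u t.
  have mE : \int[mu]_(x in @Omega R) primitive u x t = 2 * m.
    by rewrite /m /mean_primitive; field.
  have c1 : continuous_on_Omega (fun x => primitive u x t ^+ 2) by exact: contX.
  have c2 : continuous_on_Omega (fun x => - (2 * m) * primitive u x t) by exact: contM.
  have -> : \int[mu]_(x in @Omega R) (centered_primitive u x t ^+ 2) =
    \int[mu]_(x in @Omega R) (primitive u x t ^+ 2 +
        (- (2 * m) * primitive u x t + m ^+ 2)).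
    by apply: eq_Omega_integral => x _; rewrite /centered_primitive -/m; ring.
  rewrite cont_integralD//; last exact: contD.
  by rewrite cont_integralD// cont_integralZ// mE integral_cst_Omega; ring.
have cq (u : R -> R -> R) : continuous_on_Omega (primitive u ^~ t) ->
    continuous_on_Omega (fun x => centered_primitive u x t ^+ 2).
  by move=> cu; apply: contX; exact: contB.
rewrite !cont_integralD ?sq//; try (by apply: contX); try exact: cq.
move: (mean_primitive d t) (mean_primitive e t) => md me.
set I := Rintegral _ _ _; set J := Rintegral _ _ _; move: I J => I J.
by field.
Qed.

(** The mass is constant for t > 0 and within sqrt (2 L2_gap) of its value at
t = 0, which is zero. *)
Lemma mass_conserved u t : regular_xt u -> L2_initial u ->
  \int[mu]_(x in @Omega R) u x 0 = 0 ->
  (forall r : R, 0 < r -> \int[mu]_(x in @Omega R) dT u x r = 0) -> 0 < t ->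
  primitive u 1 t = 0.
Proof.
move=> ru iu u0 flux t0.
have cu := regular_cont (regular_xt_x ru).
have O1 : Omega (1 : R) by rewrite OmegaE lexx andbT -subr_ge0; lra.
have cst r : 0 < r -> primitive u 1 r = primitive u 1 t.
  move=> r0; have dp (q : R) : 0 < q -> is_derive q 1 (primitive u 1) 0.
    by move=> q0; rewrite -(flux q q0); exact: is_derive_primitive.
  have dpN (q : R) : 0 < q -> is_derive q 1 (fun z => - primitive u 1 z) 0.
    by move=> q0; rewrite -oppr0; apply: is_deriveN; exact: dp.
  (* The mass is both nonincreasing and nondecreasing. *)
  wlog rt : r t r0 t0 / r <= t.
    by move=> W; case: (leP r t) => [|/ltW] ?; [|symmetry]; exact: W.
  apply/eqP; rewrite eq_le -lerN2.
  by rewrite (nonincreasing_of_derive dpN)// (nonincreasing_of_derive dp).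
have gap r : 0 < r -> primitive u 1 t ^+ 2 <= 2 * L2_gap u r.
  move=> r0; rewrite -(cst r r0).
  have := primitive_gap iu cu r0 O1.
  by rewrite {2}/primitive -/(@Omega R) u0 subr0.
apply/eqP; rewrite -sqrf_eq0 eq_le sqr_ge0 andbT.
have H : 2 * L2_gap u r @[r --> 0^'+] --> (2 * 0 : R).
  by apply: cvgM; [exact: cvg_cst|exact: L2_gap_cvg].
rewrite -(mulr0 2); apply: (right_limit_ge t0 H) => r r0 _; exact: gap.
Qed.

End InitialLayer.

(** * Decay of the energy *)

Section Decay.
Context {R : realType}.
Variables (eps gamma m0 phi1 : R) (psi : R -> R) (delta eta phi : R -> R -> R).
Hypotheses (eps0 : 0 < eps) (gamma0 : 0 < gamma) (m00 : 0 < m0) (phi10 : 0 < phi1).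
Hypothesis gamma_large : eps * phi1 ^+ 2 <= gamma ^+ 2 * (m0 * expR (- phi1)).
Hypothesis ss : steady_state eps gamma m0 phi1 psi.
Hypothesis lp : LP_solution eps gamma m0 psi delta eta phi.
Hypothesis delta_neutral : \int[mu]_(x in @Omega R) delta x 0 = 0.
Hypothesis eta_neutral : \int[mu]_(x in @Omega R) eta x 0 = 0.

Let rdelta := LP_delta_reg lp.
Let reta := LP_eta_reg lp.
Let cdelta := regular_cont (regular_xt_x rdelta).
Let ceta := regular_cont (regular_xt_x reta).
Let rphi := LP_phi_reg lp.
Let dpsi' := antider_dpsi eps0 ss.
Let deta0 := antider_eta0 ss.
Let ddelta0 := antider_delta0 ss.

Let O1 : Omega (1 : R).
Proof. by rewrite OmegaE lexx andbT -subr_ge0; lra. Qed.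

Let ON1 : Omega (-1 : R).
Proof. by rewrite OmegaE lexx /= -subr_ge0; lra. Qed.

Lemma delta_flux x t : Omega x -> 0 < t ->
  \int[mu]_(y in `[-1, x]) dT delta y t =
  dX delta x t - eta0 m0 psi x * dX phi x t - eta x t * ddx psi x.
Proof.
move=> Ox t0; apply: (flux_identity deta0 dpsi' rdelta (regular_xt_x reta) rphi t0) => //.
  by move=> y yI; exact: (LP_delta_eq lp).
by apply: (LP_delta_bc lp) => //; left.
Qed.

Lemma eta_flux x t : Omega x -> 0 < t ->
  \int[mu]_(y in `[-1, x]) dT eta y t =
  dX eta x t - delta0 m0 psi x * dX phi x t - delta x t * ddx psi x.
Proof.
move=> Ox t0; apply: (flux_identity ddelta0 dpsi' reta (regular_xt_x rdelta) rphi t0) => //.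
  by move=> y yI; exact: (LP_eta_eq lp).
by apply: (LP_eta_bc lp) => //; left.
Qed.

Lemma delta_mass t : 0 < t -> primitive delta 1 t = 0.
Proof.
apply: mass_conserved (LP_delta_init lp) delta_neutral _ => // r r0.
rewrite [LHS](delta_flux O1 r0); apply: (LP_delta_bc lp) => //; by right.
Qed.

Lemma eta_mass t : 0 < t -> primitive eta 1 t = 0.
Proof.
apply: mass_conserved (LP_eta_init lp) eta_neutral _ => // r r0.
rewrite [LHS](eta_flux O1 r0); apply: (LP_eta_bc lp) => //; by right.
Qed.

Lemma primitiveN1 (u : R -> R -> R) t : primitive u (-1) t = 0.
Proof. by rewrite /primitive set_itv1 Rintegral_set1. Qed.

(** Poisson's equation gives phi_x = phi_x(-1) + D / eps.  As D(1) = 0, the field is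
the same at both ends, and the difference of the two Robin conditions reads
-2 gamma phi_x(-1) = 2 phi_x(-1) + 2 d / eps. *)
Lemma field_formula x t : Omega x -> 0 < t ->
  dX phi x t =
  eps^-1 * (primitive delta x t - (1 + gamma)^-1 * mean_primitive delta t).
Proof.
move=> Ox t0; set d := mean_primitive delta t.
have ie : eps^-1 * eps = 1 by rewrite mulVf// lt0r_neq0.
have cd := ST_slice cdelta t0.
have dD : antider (primitive delta ^~ t) (delta ^~ t) by exact: antider_primitive.
have dphi := antider_x rphi t0.
have dphix : antider (dX phi ^~ t) (fun y => eps^-1 * delta y t).
  apply: antiderE (antider_xx rphi t0) => y yI.
  by rewrite -(LP_phi_eq lp yI t0) mulrA ie mul1r.
have phixE y : Omega y -> dX phi y t = dX phi (-1) t + eps^-1 * primitive delta y t.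
  move=> Oy; have d0 := antiderB dphix (antiderZ eps^-1 dD).
  have d0' : antider (fun y => dX phi y t - eps^-1 * primitive delta y t) (fun=> 0).
    by apply: antiderE d0 => z _; rewrite subrr.
  have := antider0_cst d0' Oy ON1; rewrite primitiveN1 mulr0 subr0 => <-.
  by rewrite subrK.
have jump : phi 1 t - phi (-1) t = 2 * dX phi (-1) t + eps^-1 * (2 * d).
  have cc (c : R) := @cont_cst R c.
  have cD := antider_cont dD.
  rewrite -(FTC_Omega dphi (antider_cont dphix)) (eq_Omega_integral phixE).
  rewrite cont_integralD//; last exact: contM.
  rewrite cont_integralZ// integral_cst_Omega mulrC; congr (_ + _ * _).
  by rewrite /d /mean_primitive; field.
have bcr := LP_phi_bcr lp t0; have bcl := LP_phi_bcl lp t0.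
rewrite (phixE 1 O1) (delta_mass t0) mulr0 addr0 in bcr.
have g1 : 1 + gamma != 0 by rewrite lt0r_neq0// addr_gt0.
have e1 : eps != 0 by rewrite lt0r_neq0.
have E : (1 + gamma) * dX phi (-1) t = - (eps^-1 * d).
  have -> : eps^-1 * d = eps^-1 * (2 * d) / 2 by field.
  by move: jump bcr bcl; move: (eps^-1 * (2 * d)) => K *; lra.
rewrite phixE//; have -> : dX phi (-1) t = (1 + gamma)^-1 * - (eps^-1 * d).
  by rewrite -E mulKf.
by field; rewrite g1 e1.
Qed.

Local Notation Dp := (primitive delta).
Local Notation Hp := (primitive eta).

Definition energy_rate t := \int[mu]_(x in @Omega R)
  (Dp x t * \int[mu]_(y in `[-1, x]) dT delta y t
   + Hp x t * \int[mu]_(y in `[-1, x]) dT eta y t).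

(** [dissipation] applied at time t, followed by Poincare's inequality in the form
int D^2 <= 4 int delta^2. *)
Lemma energy_rate_le t : 0 < t -> energy_rate t <= - 4^-1 * energy delta eta t.
Proof.
move=> t0; rewrite /energy_rate.
have cd := ST_slice cdelta t0; have ce := ST_slice ceta t0.
have dD : antider (primitive delta ^~ t) (delta ^~ t) by exact: antider_primitive.
have dH : antider (primitive eta ^~ t) (eta ^~ t) by exact: antider_primitive.
have ddel := antider_x (regular_xt_x rdelta) t0.
have deta := antider_x (regular_xt_x reta) t0.
have cdel' := antider_cont (antider_xx (regular_xt_x rdelta) t0).
have ceta' := antider_cont (antider_xx (regular_xt_x reta) t0).
have [c0 [c0_ge c0_le c0_grad]] := eta0_range eps0 gamma0 m00 phi10 ss.
have m1 : 0 < m0 * expR (- phi1) by rewrite mulr_gt0 ?expR_gt0.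
have c00 : 0 <= c0 by exact: le_trans (ltW m1) c0_ge.
have small : eps * (5 / 8 * \int[mu]_(x in @Omega R) (ddx psi x ^+ 2)) <=
    2 * c0 * gamma.
  have P := grad_psi_le eps0 gamma0 m00 ss.
  set I := Rintegral _ _ _ in P *.
  rewrite ler_pdivlMr ?mulr_gt0// in P.
  rewrite -(ler_pM2r gamma0).
  have L : gamma ^+ 2 * (m0 * expR (- phi1)) <= gamma ^+ 2 * c0.
    by rewrite ler_wpM2l ?sqr_ge0.
  have Q := ler_wpM2l (ltW eps0) P.
  have := gamma_large; have : 0 <= gamma ^+ 2 * c0 by rewrite mulr_ge0 ?sqr_ge0.
  by move: L Q; move: (gamma ^+ 2 * (m0 * expR (- phi1))) => K; nra.
have diss := dissipation eps0 gamma0 (antider_cont ddelta0) (antider_cont deta0) dpsi'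
  c00 c0_le c0_grad small dD ddel dH deta cdel' ceta'
  (delta_mass t0) (primitiveN1 _ _) (eta_mass t0) (primitiveN1 _ _).
have -> : \int[mu]_(x in @Omega R)
    (Dp x t * \int[mu]_(y in `[-1, x]) dT delta y t
     + Hp x t * \int[mu]_(y in `[-1, x]) dT eta y t) =
  \int[mu]_(x in @Omega R)
    (Dp x t * (dX delta x t - eta0 m0 psi x *
       (eps^-1 * (Dp x t - (1 + gamma)^-1 * mean_primitive delta t)) - eta x t * ddx psi x)
   + Hp x t * (dX eta x t - delta0 m0 psi x *
       (eps^-1 * (Dp x t - (1 + gamma)^-1 * mean_primitive delta t)) - delta x t * ddx psi x)).
  apply: eq_Omega_integral => x Ox.
  by rewrite delta_flux// eta_flux// field_formula.
apply: (le_trans diss).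
have sq (u : R -> R -> R) : continuous_on_Omega (u ^~ t) ->
    antider (primitive u ^~ t) (u ^~ t) ->
    \int[mu]_(x in @Omega R) (primitive u x t ^+ 2) <=
    4 * \int[mu]_(x in @Omega R) (u x t ^+ 2).
  move=> cu du.
  have -> : 4 * \int[mu]_(x in @Omega R) (u x t ^+ 2) =
     \int[mu]_(x in @Omega R) (2 * \int[mu]_(x in @Omega R) (u x t ^+ 2)).
    by rewrite integral_cst_Omega; ring.
  apply: cont_le_integral; [exact: contX (antider_cont du)|exact: cont_cst|].
  by move=> x Ox; apply: (poincare du cu _ Ox); rewrite primitiveN1.
have cD := antider_cont dD; have cH := antider_cont dH.
rewrite energyE// !cont_integralD//; try exact: contX.
move: (sq _ cd dD) (sq _ ce dH).
set I1 := Rintegral _ _ _; set I2 := Rintegral _ _ _.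
set I3 := Rintegral _ _ _; set I4 := Rintegral _ _ _.
by move: I1 I2 I3 I4 => I1 I2 I3 I4; lra.
Qed.

Lemma is_derive_energy (t : R) : 0 < t ->
  is_derive t 1 (energy delta eta) (energy_rate t).
Proof.
move=> t0.
have t2 : 0 < t / 2 by rewrite divr_gt0.
have ab : t / 2 <= t * 2 by lra.
have [C1 C10 B1] := ST_bounded cdelta t2 ab.
have [C2 C20 B2] := ST_bounded ceta t2 ab.
have [C3 C30 B3] := ST_bounded (regular_cont_t rdelta) t2 ab.
have [C4 C40 B4] := ST_bounded (regular_cont_t reta) t2 ab.
pose f x r := 2^-1 * (Dp x r ^+ 2 + Hp x r ^+ 2).
pose f' x r := Dp x r * (\int[mu]_(y in `[-1, x]) dT delta y r)
   + Hp x r * (\int[mu]_(y in `[-1, x]) dT eta y r).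
have cf (r : R) : 0 < r -> continuous_on_Omega (fun x => Dp x r ^+ 2 + Hp x r ^+ 2).
  move=> r0; apply: contD; apply: contX; apply: cont_primitive_at => //; try exact: ltW.
    exact: (LP_delta_init lp).
  exact: (LP_eta_init lp).
have dE : is_derive t 1 (fun r => \int[mu]_(x in @Omega R) f x r)
    (\int[mu]_(x in @Omega R) f' x t).
  apply: (@is_derive_integral _ _ f f' (t / 2) (t * 2) (2 * C1 * (2 * C3) + 2 * C2 * (2 * C4))).
  - exact: measurable_Omega.
  - by [].
  - move=> r /andP[r1 _]; apply: integrableR_scale; first exact: measurable_Omega.
    by apply: cont_integrable; apply: cf; exact: lt_trans r1.
  - move=> x r Ox /andP[r1 _]; have r0 : 0 < r by exact: lt_trans r1.
    have d1 := is_derive_primitive rdelta r0 Ox.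
    have d2 := is_derive_primitive reta r0 Ox.
    have d3 := is_deriveD (is_deriveX 2 d1) (is_deriveX 2 d2).
    apply: (is_derive_congr (@is_deriveZ _ _ _ _ 2^-1 _ _ _ d3)).
    rewrite /f' /GRing.scale /= !expr1.
    move: (Dp x r) (Hp x r) (\int[mu]_(y in `[-1, x]) dT delta y r)
      (\int[mu]_(y in `[-1, x]) dT eta y r) => p q p' q'.
    by field.
  - move=> x r Ox /andP[r1 r2]; have r0 : 0 < r by exact: lt_trans r1.
    have rI : t / 2 <= r <= t * 2 by rewrite !ltW.
    have p (u : R -> R -> R) C : continuous_ST u -> 0 <= C ->
       (forall x t', Omega x -> t / 2 <= t' <= t * 2 -> `|u x t'| <= C) ->
       `|\int[mu]_(y in `[-1, x]) u y r| <= 2 * C.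
      move=> cu C0 uC; apply: abs_primitive_le => //; first exact: ST_slice.
      by move=> y Oy; exact: uC.
    rewrite /f'; apply: (le_trans (ler_normD _ _)).
    apply: lerD; rewrite normrM; apply: ler_pM => //.
    - exact: p cdelta C10 B1.
    - exact: p (regular_cont_t rdelta) C30 B3.
    - exact: p ceta C20 B2.
    - exact: p (regular_cont_t reta) C40 B4.
  - by rewrite addr_ge0 ?mulr_ge0.
  - by apply/andP; split; lra.
apply: near_eq_is_derive dE; near=> r.
have r0 : 0 < r by near: r; exact: lt_nbhsr.
rewrite /f energyE ?cont_integralZ//; first exact: cf.
- by apply: cont_primitive_at => //; [exact: (LP_delta_init lp)|exact: ltW].
- by apply: cont_primitive_at => //; [exact: (LP_eta_init lp)|exact: ltW].
Unshelve. all: by end_near. Qed.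

(** Young's inequality a^2 <= (1 + theta) b^2 + (1 + 1/theta) (a - b)^2 compares
the energies at times s and 0 up to a factor as close to 1 as desired. *)
Lemma energy_initial (theta s : R) : 0 < theta -> 0 < s ->
  energy delta eta s <= (1 + theta) * energy delta eta 0
    + (1 + theta^-1) * 2 * (L2_gap delta s + L2_gap eta s).
Proof.
move=> th0 s0.
have id := LP_delta_init lp; have ie := LP_eta_init lp.
have cD (r : R) : 0 <= r -> continuous_on_Omega (Dp ^~ r) by exact: cont_primitive_at.
have cH (r : R) : 0 <= r -> continuous_on_Omega (Hp ^~ r) by exact: cont_primitive_at.
have cD0 := cD _ (lexx 0); have cH0 := cH _ (lexx 0).
have cDs := cD _ (ltW s0); have cHs := cH _ (ltW s0).
rewrite !energyE//.
set c := (1 + theta^-1) * 2 * _.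
have young (a b : R) : a ^+ 2 <= (1 + theta) * b ^+ 2 + (1 + theta^-1) * (a - b) ^+ 2.
  rewrite -subr_ge0.
  have -> : (1 + theta) * b ^+ 2 + (1 + theta^-1) * (a - b) ^+ 2 - a ^+ 2 =
    theta^-1 * (a - b - theta * b) ^+ 2 by field; exact: lt0r_neq0.
  by rewrite mulr_ge0 ?sqr_ge0// invr_ge0 ltW.
have t1 : 0 <= 1 + theta^-1 by rewrite addr_ge0// invr_ge0 ltW.
have cs0 : continuous_on_Omega (fun x => Dp x 0 ^+ 2 + Hp x 0 ^+ 2).
  by apply: contD; exact: contX.
have cc (a : R) := @cont_cst R a.
have H : \int[mu]_(x in @Omega R) (Dp x s ^+ 2 + Hp x s ^+ 2) <=
  \int[mu]_(x in @Omega R) ((1 + theta) * (Dp x 0 ^+ 2 + Hp x 0 ^+ 2) + c).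
  apply: cont_le_integral.
  - by apply: contD; exact: contX.
  - by apply: contD => //; exact: contM.
  move=> x Ox.
  have g1 := ler_wpM2l t1 (primitive_gap id cdelta s0 Ox).
  have g2 := ler_wpM2l t1 (primitive_gap ie ceta s0 Ox).
  have y1 := young (Dp x s) (Dp x 0); have y2 := young (Hp x s) (Hp x 0).
  by rewrite /c; lra.
have S : \int[mu]_(x in @Omega R) ((1 + theta) * (Dp x 0 ^+ 2 + Hp x 0 ^+ 2) + c) =
    (1 + theta) * \int[mu]_(x in @Omega R) (Dp x 0 ^+ 2 + Hp x 0 ^+ 2) + c * 2.
  rewrite cont_integralD//; last exact: contM.
  by congr (_ + _); [exact: cont_integralZ|exact: integral_cst_Omega].
rewrite {}S in H; move: c H.
set I := Rintegral _ _ _; set J := Rintegral _ _ _; move: I J => I J c H.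
by lra.
Qed.

(** Let s -> 0+ in Y(t) <= Y(s), Y(s) = E(s) exp(s/4), using [energy_initial] with
theta fixed, and then let theta -> 0+. *)
Lemma energy_decay t : 0 < t ->
  energy delta eta t <= energy delta eta 0 * expR (- 4^-1 * t).
Proof.
move=> t0.
pose E := energy delta eta.
pose Y r := E r * expR (4^-1 * r).
have dY (r : R) : 0 < r -> is_derive r 1 Y
    ((energy_rate r + 4^-1 * E r) * expR (4^-1 * r)).
  move=> r0; have dEr := is_derive_energy r0.
  have dl : is_derive r 1 (fun z : R => 4^-1 * z) 4^-1.
    by apply: is_derive_eq; rewrite /GRing.scale /= mulr1.
  have dexp := @is_derive1_comp _ expR (fun z : R => 4^-1 * z) r _ _
    (is_derive_expR _) dl.
  apply: (is_derive_congr (is_deriveM dEr dexp)).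
  by rewrite /GRing.scale /= /E; ring.
have Y'0 (r : R) : 0 < r -> (energy_rate r + 4^-1 * E r) * expR (4^-1 * r) <= 0.
  move=> r0; rewrite mulr_le0_ge0 ?expR_ge0//.
  by have := energy_rate_le r0; rewrite -/(E r); lra.
have mono (s : R) : 0 < s -> s <= t -> Y t <= Y s.
  exact: nonincreasing_of_derive.
have E0 : 0 <= E 0.
  rewrite /E energyE; last 2 first.
  - exact: cont_primitive_at (LP_delta_init lp) cdelta (lexx 0).
  - exact: cont_primitive_at (LP_eta_init lp) ceta (lexx 0).
  rewrite mulr_ge0 ?invr_ge0//; apply: Rintegral_ge0 => x _.
  by rewrite addr_ge0 ?sqr_ge0.
have key (theta : R) : 0 < theta -> Y t <= (1 + theta) * E 0.
  move=> th0.
  pose Z r := ((1 + theta) * E 0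
    + (1 + theta^-1) * 2 * (L2_gap delta r + L2_gap eta r)) * expR (4^-1 * r).
  have Zl : Z r @[r --> 0^'+] -->
      ((1 + theta) * E 0 + (1 + theta^-1) * 2 * (0 + 0)) * expR (4^-1 * 0).
    apply: cvgM.
      apply: cvgD; first exact: cvg_cst.
      apply: cvgM; first exact: cvg_cst.
      by apply: cvgD; apply: L2_gap_cvg; [exact: (LP_delta_init lp)|exact: (LP_eta_init lp)].
    apply: continuous_cvg; first exact: continuous_expR.
    apply: cvgM; first exact: cvg_cst.
    by apply: cvg_at_right_filter; exact: cvg_id.
  rewrite !mulr0 addr0 mulr0 addr0 expR0 mulr1 in Zl.
  apply: (right_limit_ge t0 Zl) => r r0 rt; apply: le_trans (mono r r0 rt) _.
  by rewrite /Y /Z ler_pM2r ?expR_gt0//; exact: energy_initial.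
have YE : Y t <= E 0.
  apply/ler_addgt0Pr => e e0.
  have E1 : 0 < E 0 + 1 by rewrite ltr_wpDl.
  (* E 0 + 1 rather than E 0, which may vanish. *)
  apply: le_trans (key (e / (E 0 + 1)) _) _; first exact: divr_gt0.
  rewrite mulrDl mul1r lerD2l mulrAC ler_pdivrMr// ler_pM2l//.
  by rewrite lerDl.
by rewrite mulNr expRN ler_pdivlMr ?expR_gt0.
Qed.

End Decay.

Theorem corollary1p2 (R : realType) (m0 phi1 : R) (hm0 : 0 < m0) (hphi1 : 0 < phi1) :
  exists2 eps_max : R, 0 < eps_max &
  forall gamma_max : R, 0 < gamma_max ->
  exists2 alpha : R, 0 < alpha &
  forall eps : R, 0 < eps < eps_max ->
  forall gamma : R, 0 < gamma <= gamma_max ->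
  gamma / Num.sqrt eps >
    ((1 + 2 * gamma_max) ^+ 2 + 3) * K0 phi1 * phi1 / (4 * M m0 phi1) ->
  forall psi : R -> R, steady_state eps gamma m0 phi1 psi ->
  forall delta eta phi : R -> R -> R,
  LP_solution eps gamma m0 psi delta eta phi ->
  \int[lebesgue_measure]_(x in @Omega R) delta x 0 = 0 ->
  \int[lebesgue_measure]_(x in @Omega R) eta x 0 = 0 ->
  forall t : R, 0 < t ->
  energy delta eta t <= energy delta eta 0 * expR (- alpha * t).
Proof.
exists 1 => // gamma_max gm; exists 4^-1; first by rewrite invr_gt0.
move=> eps /andP[e0 _] gamma /andP[g0 _] hyp psi ss delta eta phi lp d0 n0 t t0.
apply: (@energy_decay _ eps gamma m0 phi1 psi delta eta phi) => //.
exact: gamma_sqr_ge hyp.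
Qed.
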